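(* Let $\mathcal{M}_0,\mathcal{E}_0\in(0,\infty)$ be a given mass and energy. We describe the maximizers of the quantum entropy $\mathcal{H}_{qu}$ over nonnegative measures $\lambda$ on $\mathbb{T}^d$ under the constraints $\mathcal{M}(\lambda)=\mathcal{M}_0$ and $\mathcal{E}(\lambda)=\mathcal{E}_0$. Let $f_\pm$ (see the context) be two differentiable, increasing functions satisfying $f_+(0)=f_-(0)=0$, with the following linear asymptotic behavior as $\mathcal{M}\to\infty$: $$f_+(\mathcal{M})\approx\beta\mathcal{M}\quad\text{and}\quad f_-(\mathcal{M})\approx\alpha\mathcal{M}.$$ (i) If $f_-(\mathcal{M}_0)<\mathcal{E}_0<f_+(\mathcal{M}_0)$, the unique maximizer is the unique Bose-Einstein equilibrium distribution with this mass and energy. This corresponds to the interior of the region $S$ of the $(\mathcal{M},\mathcal{E})$ plane. (ii) If $f_+(\mathcal{M}_0)\le\mathcal{E}_0<\mathcal{M}_0$, the maximizers have the form $B_{\mu,\nu}+\lambda_{\mathrm{sing}}$, where $\lambda_{\mathrm{sing}}$ is concentrated in the region where $\omega=1$. This corresponds to the region above $S$ and below the line $\mathcal{E}=\mathcal{M}$. (iii) If $a\mathcal{M}_0<\mathcal{E}_0\le f_-(\mathcal{M}_0)$, an analogous statement as in (ii) holds, with the maximizers being of the form $B_{\mu,\nu}+\lambda_{\mathrm{sing}}$. This corresponds to the region below $S$ and above the line $\mathcal{E}=a\mathcal{M}$.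
   Context: $\mathbb{T}^d=\mathbb{R}^d/(2\pi\mathbb{Z})^d$, with Lebesgue measure $dp$ (total mass $(2\pi)^d$). The dispersion relation $\omega:\mathbb{T}^d\to[0,\infty)$ is a fixed continuous function with $\min\omega=a\ge 0$ and $\max\omega=1$, taking its maximal and minimal values on sets of Lebesgue measure zero. A nonnegative measure $\lambda$ on $\mathbb{T}^d$ is decomposed as $d\lambda=f\,dp+d\lambda_{\mathrm{sing}}$, into a part absolutely continuous with respect to Lebesgue measure and a singular part. Mass, energy and quantum entropy are $$\mathcal{M}(\lambda)=\int_{\mathbb{T}^d}d\lambda,\quad \mathcal{E}(\lambda)=\int_{\mathbb{T}^d}\omega\,d\lambda,\quad \mathcal{H}_{qu}(\lambda)=\int_{\mathbb{T}^d}\big[(1+f)\ln(1+f)-f\ln f\big]dp,$$ so the entropy only sees the absolutely continuous part. A nonnegative function $g$ is identified with the measure $g\,dp$, and $\mathcal{M}(g)$, $\mathcal{E}(g)$ denote its mass and energy. A Bose-Einstein equilibrium is a function $B_{\mu,\nu}(p)=\frac{1}{e^{\mu\omega(p)+\nu}-1}$ with real $(\mu,\nu)\ne(0,0)$ such that $\mu\omega+\nu\ge 0$ on $\mathbb{T}^d$. Constants: $$\alpha=a+(2\pi)^d\Big(\int_{\mathbb{T}^d}\frac{dp}{\omega-a}\Big)^{-1},\qquad \beta=1-(2\pi)^d\Big(\int_{\mathbb{T}^d}\frac{dp}{1-\omega}\Big)^{-1},$$ with the convention $\infty^{-1}=0$. The functions $f_\pm$: when $\int\frac{dp}{\omega-a}$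 and $\int\frac{dp}{1-\omega}$ are finite, $f_\pm$ are the functions of the mass whose graphs over $(0,\infty)$ are the curves $$\mathcal{C}_+=\{(\mathcal{M}(B_{-t,t}),\mathcal{E}(B_{-t,t})):t\in(0,\infty)\},\qquad \mathcal{C}_-=\{(\mathcal{M}(B_{t,-at}),\mathcal{E}(B_{t,-at})):t\in(0,\infty)\},$$ respectively, and $S$ is the subset of the $(\mathcal{M},\mathcal{E})$ plane bounded above by $\mathcal{C}_+$ and below by $\mathcal{C}_-$. *)

(* Defs.v *)
From HB Require Import structures.
From mathcomp Require Import all_boot all_order all_algebra.
From mathcomp Require Import all_classical all_reals all_analysis.
From mathcomp Require Import measurable_realfun.

Set Implicit Arguments.
Unset Strict Implicit.
Unset Printing Implicit Defensive.
Import Order.TTheory GRing.Theory Num.Theory.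
Import numFieldNormedType.Exports.

Local Open Scope classical_set_scope.
Local Open Scope ring_scope.

Section torus.
Variables (R : realType) (d : nat).

(* x and y differ by an element of (2 pi Z)^d *)
Definition lattice_equiv (x y : 'rV[R]_d) : bool :=
  `[< exists k : 'I_d -> int, forall i, x 0 i - y 0 i = 2 * pi * (k i)%:~R >].

Lemma lattice_equiv_refl : reflexive lattice_equiv.
Proof.
by move=> x; apply/asboolP; exists (fun=> 0) => i; rewrite subrr mulr0.
Qed.

Lemma lattice_equiv_sym : symmetric lattice_equiv.
Proof.
suff sub x y : lattice_equiv x y -> lattice_equiv y x.
  by move=> x y; apply/idP/idP; exact: sub.
move=> /asboolP[k kP]; apply/asboolP; exists (fun i => - k i) => i.
by rewrite -opprB kP rmorphN mulrN.
Qed.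

Lemma lattice_equiv_trans : transitive lattice_equiv.
Proof.
move=> y x z /asboolP[k kP] /asboolP[l lP]; apply/asboolP.
exists (fun i => k i + l i) => i.
by rewrite rmorphD mulrDr -kP -lP addrA subrK.
Qed.

Canonical lattice_equiv_rel := EquivRel lattice_equiv
  lattice_equiv_refl lattice_equiv_sym lattice_equiv_trans.

Definition torus : Type :=
  quotient_topology {eq_quot lattice_equiv_rel}%qT.

HB.instance Definition _ := PointedTopological.on torus.

(* Borel sets of the quotient topology *)
HB.instance Definition _ := Measurable.copy torus
  (g_sigma_algebraType (@open torus)).

End torus.

(* Lebesgue measure on R^n, by induction on n as an iterated product. *)
Section lebesgue_tuple.
Variable R : realType.
Local Notation mR := (measurableTypeR R).

Definition lebesgue_tuple0 : set (0.-tuple mR) -> \bar R :=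
  dirac [tuple].
HB.instance Definition _ := SigmaFiniteMeasure.on lebesgue_tuple0.

Section step.
Variables (n : nat) (m : {sigma_finite_measure set (n.-tuple mR) -> \bar R}).

Definition tuple_cons (x : mR * n.-tuple mR) : n.+1.-tuple mR :=
  [tuple of x.1 :: x.2].

Lemma measurable_tuple_cons : measurable_fun [set: mR * n.-tuple mR] tuple_cons.
Proof. exact: measurable_cons. Qed.

Definition lebesgue_tupleS : set (n.+1.-tuple mR) -> \bar R :=
  pushforward ((@lebesgue_measure R) \x m)%E tuple_cons.

Let tupleS0 : lebesgue_tupleS set0 = 0%E.
Proof. by rewrite /lebesgue_tupleS /pushforward preimage_set0 measure0. Qed.

Let tupleS_ge0 A : (0 <= lebesgue_tupleS A)%E.
Proof. by rewrite /lebesgue_tupleS /pushforward; exact: measure_ge0. Qed.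

Let tupleS_sigma_additive : semi_sigma_additive lebesgue_tupleS.
Proof.
apply: (@measure_semi_sigma_additive _ _ _
  (pushforward ((@lebesgue_measure R) \x m)%E tuple_cons)).
exact: measurable_tuple_cons.
Qed.

HB.instance Definition _ := isMeasure.Build _ _ _ lebesgue_tupleS
  tupleS0 tupleS_ge0 tupleS_sigma_additive.

Let tupleS_sigma_finite : sigma_finite setT lebesgue_tupleS.
Proof.
have /sigma_finiteP[F [TF ndF Foo]] := sigma_finiteT (@lebesgue_measure R).
have /sigma_finiteP[G [TG ndG Goo]] := sigma_finiteT m.
pose behd (t : n.+1.-tuple mR) : n.-tuple mR := [tuple of behead t].
exists (fun k => (@tnth n.+1 mR ^~ ord0) @^-1` F k `&` behd @^-1` G k).
  apply/esym; rewrite -subTset => t _.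
  have [i _ Fi] : (\bigcup_i F i) (tnth t ord0) by rewrite -TF.
  have [j _ Gj] : (\bigcup_i G i) (behd t) by rewrite -TG.
  exists (maxn i j) => //; split.
  - have /subsetPset := ndF i (maxn i j) (leq_maxl i j); exact.
  - have /subsetPset := ndG j (maxn i j) (leq_maxr i j); exact.
move=> k; have [mF Fk] := Foo k; have [mG Gk] := Goo k; split.
  apply: measurableI; rewrite -[X in measurable X]setTI.
  - exact: measurable_tnth.
  - exact: measurable_behead.
rewrite /lebesgue_tupleS /pushforward.
set X := _ @^-1` _.
have -> : X = F k `*` G k.
  have behdK x (t : n.-tuple mR) : behd (tuple_cons (x, t)) = t.
    exact: val_inj.
  by apply/seteqP; split => -[x t]; rewrite /X /= tnth0 behdK.
rewrite product_measure1E// lte_mul_pinfty//.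
by rewrite ge0_fin_numE.
Qed.

HB.instance Definition _ := Measure_isSigmaFinite.Build _ _ _ lebesgue_tupleS
  tupleS_sigma_finite.
End step.

Fixpoint lebesgue_tuple n : {sigma_finite_measure set (n.-tuple mR) -> \bar R} :=
  match n with
  | 0%N => lebesgue_tuple0
  | k.+1 => lebesgue_tupleS (lebesgue_tuple k)
  end.

End lebesgue_tuple.

(* Lebesgue measure on the torus: the image under R^d -> torus of Lebesgue
   measure on the fundamental cell [0, 2 pi)^d. *)
Section torus_lebesgue.
Variables (R : realType) (d : nat).
Local Notation mR := (measurableTypeR R).
Local Notation torus := (torus R d).

Definition cell : set (d.-tuple mR) :=
  [set t | forall i, 0 <= tnth t i :> R /\ tnth t i < 2 * pi :> R].

Definition torus_proj (t : d.-tuple mR) : torus :=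
  (\pi_torus (\row_i (tnth t i : R)))%qT.

Lemma measurable_cell : measurable cell.
Proof.
have -> : cell = \bigcap_(i : 'I_d) ((@tnth d mR ^~ i) @^-1` `[0, 2 * pi[).
  apply/seteqP; split => t /= h i; first by move=> _; rewrite /= in_itv/=; apply/andP.
  by have := h i I; rewrite /= in_itv/= => /andP.
apply: fin_bigcap_measurable => [|i _]; first exact: finite_finset.
by rewrite -[X in measurable X]setTI; exact: measurable_tnth.
Qed.

Lemma measurable_torus_proj : measurable_fun setT torus_proj.
Proof.
apply: (measurability (@open torus)) => // _ [U oU <-]; rewrite setTI.
pose row_of (t : d.-tuple mR) : 'rV[R]_d := \row_i (tnth t i : R).
pose V : set 'rV[R]_d := \pi_torus%qT @^-1` U.
have oV : open V by exact: oU.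
pose box (q : 'rV[rat]_d * rat) : set 'rV[R]_d :=
  [set x | forall i, `|ratr (q.1 0 i) - x 0 i| < ratr q.2].
have -> : torus_proj @^-1` U =
    \bigcup_(q in [set q | box q `<=` V]) (row_of @^-1` box q).
  apply/seteqP; split => t; last by move=> [q /= qV] /qV.
  move=> Vt; have : nbhs (row_of t) V by exact: open_nbhs_nbhs.
  move=> /nbhs_ballP[e /= e0 eV].
  have [r] := rat_in_itvoo (divr_gt0 e0 (ltr0Sn R 1)).
  rewrite in_itv/= => /andP[r0 re].
  have /choice[q qP] : forall i, exists q : rat, `|ratr q - tnth t i| < ratr r.
    move=> i; have tr : (tnth t i - ratr r : R) < tnth t i + ratr r.
      by rewrite ltrBlDr -addrA ltrDl addr_gt0.
    have [q] := rat_in_itvoo tr; rewrite in_itv/= => /andP[q1 q2].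
    by exists q; rewrite ltr_distl q1 q2.
  exists (\row_i q i, r) => /=; last by move=> i; rewrite !mxE.
  move=> x xr; apply: eV; split => // i j; rewrite !ord1 /ball/= mxE.
  have := xr j; rewrite mxE => xrj.
  rewrite (le_lt_trans (ler_distD (ratr (q j)) _ _))//.
  rewrite (splitr e) ltrD// (lt_trans _ re)//.
  by rewrite distrC.
rewrite bigcup_mkcond; apply: countable_bigcupT_measurable => // q.
case: ifP => // _.
have -> : row_of @^-1` box q = \bigcap_(i : 'I_d) ((@tnth d mR ^~ i) @^-1`
    (ball (ratr (q.1 0 i) : R) (ratr q.2))).
  apply/seteqP; split => t /= h i; last by have := h i I; rewrite /= mxE.
  by move=> _; have := h i; rewrite mxE.
apply: fin_bigcap_measurable => [|i _]; first exact: finite_finset.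
rewrite -[X in measurable X]setTI; apply: measurable_tnth => //.
by rewrite ball_itv; exact: measurable_itv.
Qed.

Definition torus_lebesgue : set torus -> \bar R :=
  pushforward (mrestr (lebesgue_tuple R d) measurable_cell) torus_proj.

Let torus_lebesgue0 : torus_lebesgue set0 = 0%E.
Proof. by rewrite /torus_lebesgue /pushforward preimage_set0 measure0. Qed.

Let torus_lebesgue_ge0 A : (0 <= torus_lebesgue A)%E.
Proof. by rewrite /torus_lebesgue /pushforward; exact: measure_ge0. Qed.

Let torus_lebesgue_sigma_additive : semi_sigma_additive torus_lebesgue.
Proof.
apply: (@measure_semi_sigma_additive _ _ _
  (pushforward (mrestr (lebesgue_tuple R d) measurable_cell) torus_proj)).
exact: measurable_torus_proj.
Qed.

HB.instance Definition _ := isMeasure.Build _ _ _ torus_lebesgue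
  torus_lebesgue0 torus_lebesgue_ge0 torus_lebesgue_sigma_additive.

End torus_lebesgue.

Section torus_mass.
Local Open Scope ereal_scope.

Lemma lebesgue_tupleSE (R : realType) n (A : set (measurableTypeR R))
    (B : set (n.-tuple (measurableTypeR R))) : measurable A -> measurable B ->
  lebesgue_tuple R n.+1 [set t | A (thead t) /\ B [tuple of behead t]] =
  @lebesgue_measure R A * lebesgue_tuple R n B.
Proof.
move=> mA mB; rewrite /= /lebesgue_tupleS /pushforward -product_measure1E//.
congr ((_ \x _) _).
by apply/seteqP; split=> -[x t] /=; rewrite theadE (_ : [tuple of _] = t) //; apply: val_inj.
Qed.

Lemma lebesgue_cell (R : realType) d :
  lebesgue_tuple R d (@cell R d) = ((2 * pi) ^+ d)%R%:E.
Proof.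
elim: d => [|d IH].
  by rewrite /= /lebesgue_tuple0 diracE mem_set// => -[].
rewrite exprS EFinM -IH.
have -> : @cell R d.+1 =
    [set t | `[0%R, (2 * pi)%R[%classic (thead t : R) /\
      @cell R d [tuple of behead t]].
  apply/seteqP; split=> t.
    move=> h; split; first by rewrite /= in_itv/=; apply/andP; exact: h ord0.
    by move=> i; rewrite tnth_behead; exact: h.
  move=> [/= h0 h] i; case: (unliftP ord0 i) => [j ->|->].
    have := h j; rewrite tnth_behead (_ : inord _ = lift ord0 j)//.
    by apply/val_inj; rewrite /= inordK// ltnS.
  by move: h0; rewrite in_itv => /andP.
rewrite lebesgue_tupleSE//; last exact: measurable_cell.
by rewrite lebesgue_measure_itv/= lte_fin mulr_gt0 ?pi_gt0// oppr0 addr0.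
Qed.

Lemma torus_lebesgueT (R : realType) d :
  @torus_lebesgue R d setT = ((2 * pi) ^+ d)%R%:E.
Proof.
rewrite /torus_lebesgue /pushforward /mrestr preimage_setT setTI.
exact: lebesgue_cell.
Qed.

End torus_mass.

Section bose_einstein.
Local Open Scope ereal_scope.
Variables (R : realType) (d : nat).
Local Notation torus := (torus R d).
Local Notation dp := (@torus_lebesgue R d).
Implicit Types (omega : torus -> R) (f g : torus -> \bar R).
Implicit Types (lambda sigma : {measure set torus -> \bar R}).

Definition dispersion_relation omega (a : R) : Prop :=
  [/\ continuous omega,
      (0 <= a)%R,
      (forall p, a <= omega p <= 1)%R,
      (exists p, omega p = a) /\ (exists p, omega p = 1%R) &
      dp [set p | omega p = a] = 0 /\ dp [set p | omega p = 1%R] = 0].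

Definition singular sigma : Prop :=
  exists N, [/\ measurable N, dp N = 0 & sigma (~` N) = 0].

Definition lebesgue_decomposition lambda f sigma : Prop :=
  [/\ measurable_fun setT f,
      (forall p, 0 <= f p),
      singular sigma &
      forall A, measurable A -> lambda A = \int[dp]_(p in A) f p + sigma A].

(* Unique up to a null set whenever lambda is finite. *)
Definition ac_density lambda : torus -> \bar R :=
  xget (cst 0) [set f | exists sigma, lebesgue_decomposition lambda f sigma].

Definition mass lambda : \bar R := lambda [set: torus].

Definition energy omega lambda : \bar R := \int[lambda]_p (omega p)%:E.

(* The convention 0 ln 0 = 0 holds because ln 0 = 0 here. *)
Definition bose_entropy (x : R) : R := ((1 + x) * ln (1 + x) - x * ln x)%R.

Definition quantum_entropy lambda : \bar R :=
  \int[dp]_p (bose_entropy (fine (ac_density lambda p)))%:E.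

Definition entropy_maximizer omega (M0 E0 : R) lambda : Prop :=
  [/\ mass lambda = M0%:E, energy omega lambda = E0%:E &
      forall lambda', mass lambda' = M0%:E -> energy omega lambda' = E0%:E ->
        quantum_entropy lambda' <= quantum_entropy lambda].

Definition has_density lambda g : Prop :=
  forall A, measurable A -> lambda A = \int[dp]_(p in A) g p.

Definition mass_dens g : \bar R := \int[dp]_p g p.

Definition energy_dens omega g : \bar R := \int[dp]_p ((omega p)%:E * g p).

(* The inverse is that of \bar R: the value is +oo where mu omega + nu = 0. *)
Definition bose_einstein omega (mu nu : R) : torus -> \bar R :=
  fun p => ((expR (mu * omega p + nu) - 1)%R%:E)^-1.

Definition is_equilibrium omega g : Prop :=
  exists mu nu : R, [/\ (mu, nu) <> (0%R, 0%R),
    (forall p, 0 <= mu * omega p + nu)%R & g = bose_einstein omega mu nu].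

Definition inv_gap_bot omega (a : R) : \bar R :=
  \int[dp]_p ((omega p - a)%R%:E)^-1.

Definition inv_gap_top omega : \bar R :=
  \int[dp]_p ((1 - omega p)%R%:E)^-1.

(* +oo^-1 = 0 in \bar R *)
Definition alpha omega (a : R) : R :=
  (a + (2 * pi) ^+ d * fine (inv_gap_bot omega a)^-1)%R.

Definition beta omega : R :=
  (1 - (2 * pi) ^+ d * fine (inv_gap_top omega)^-1)%R.

Definition curve_top omega : set (\bar R * \bar R) :=
  [set (let B := bose_einstein omega (- t) t in
        (mass_dens B, energy_dens omega B)) | t in [set t : R | (0 < t)%R]].

Definition curve_bot omega (a : R) : set (\bar R * \bar R) :=
  [set (let B := bose_einstein omega t (- a * t) in
        (mass_dens B, energy_dens omega B)) | t in [set t : R | (0 < t)%R]].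

Definition pos_graph (f : R -> R) : set (\bar R * \bar R) :=
  [set (M%:E, (f M)%:E) | M in [set M : R | (0 < M)%R]].

(* When the integral diverges, the equilibria of the corresponding curve have
   infinite mass and the constraint degenerates to the extreme line E = M
   (resp. E = a M), in accordance with beta = 1 (resp. alpha = a). *)
Definition top_branch omega (f : R -> R) : Prop :=
  [/\ f 0%R = 0%R,
      inv_gap_top omega < +oo -> pos_graph f = curve_top omega &
      inv_gap_top omega = +oo -> forall M, (0 <= M)%R -> f M = M].

Definition bot_branch omega (a : R) (f : R -> R) : Prop :=
  [/\ f 0%R = 0%R,
      inv_gap_bot omega a < +oo -> pos_graph f = curve_bot omega a &
      inv_gap_bot omega a = +oo -> forall M, (0 <= M)%R -> f M = (a * M)%R].

End bose_einstein.

Section halfline.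
Variable R : realType.
Implicit Types (f : R -> R) (S : set (R * R)).

Definition differentiable_halfline f : Prop :=
  (forall M, 0 < M -> derivable f M 1) /\
  cvg ((f h - f 0) / h @[h --> 0^'+]).

Definition increasing_halfline f : Prop :=
  forall x y, 0 <= x -> x < y -> f x < f y.

Definition nondecreasing_halfline f : Prop :=
  forall x y, 0 <= x -> x <= y -> f x <= f y.

Definition asymptotic_slope f (c : R) : Prop := f M / M @[M --> +oo] --> c.

Definition region_between (fm fp : R -> R) : set (R * R) :=
  [set z | 0 < z.1 /\ fm z.1 <= z.2 <= fp z.1].

Definition above S : set (R * R) :=
  [set z | 0 < z.1 /\ forall E, S (z.1, E) -> E <= z.2].

Definition below S : set (R * R) :=
  [set z | 0 < z.1 /\ forall E, S (z.1, E) -> z.2 <= E].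

End halfline.

Section maximizers.
Variables (R : realType) (d : nat).

Definition unique_equilibrium_maximizer (omega : torus R d -> R) (M0 E0 : R) :
    Prop :=
  exists g,
    unique (fun g' => [/\ is_equilibrium omega g', mass_dens g' = M0%:E &
                          energy_dens omega g' = E0%:E]) g /\
    forall lambda, entropy_maximizer omega M0 E0 lambda <-> has_density lambda g.

Definition maximizers_condense_at (omega : torus R d -> R) (c M0 E0 : R) :
    Prop :=
  (exists lambda, entropy_maximizer omega M0 E0 lambda) /\
  forall lambda, entropy_maximizer omega M0 E0 lambda ->
    exists g (sigma : {measure set torus R d -> \bar R}),
      [/\ is_equilibrium omega g, lebesgue_decomposition lambda g sigma &
          sigma (~` [set p | omega p = c]) = 0%E].

End maximizers.

(* Main.v *)
Require Import Defs.
From HB Require Import structures.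
From mathcomp Require Import all_boot all_order all_algebra.
From mathcomp Require Import all_classical all_reals all_analysis.
From mathcomp Require Import measurable_realfun ring lra.
Set Implicit Arguments.
Unset Strict Implicit.
Unset Printing Implicit Defensive.
Import Order.TTheory GRing.Theory Num.Theory.
Import numFieldNormedType.Exports.
Local Open Scope classical_set_scope.
Local Open Scope ring_scope.

(** Write [theta = mu omega + nu], so that [B = 1 / (e^theta - 1)].  The concave
    function [h x = (1 + x) ln (1 + x) - x ln x] lies below its tangent of slope
    [theta], [h x <= theta x + ln (1 + B)], with equality only at [x = B].
    Integrating against [dp], a competitor [f dp + sigma] of mass [M0] and energy
    [E0] has entropy at most [mu E0 + nu M0 + \int ln (1 + B)], with equality iff
    [f = B] almost everywhere and [\int theta dsigma = 0].  A competitor without a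
    Lebesgue decomposition needs no attention, as its entropy is [0] by the
    convention in [ac_density].  It remains to solve the constraints.

    Put [s = 1 - omega] or [s = omega - a].  On the corresponding boundary curve
    [theta = t s], and the mass [\int bose (t s)] and the gap [\int s bose (t s)]
    both decrease in [t] from [+oo] to [0].  The gap as a function of the mass is
    the distance from the curve to the line [E = M], resp. [E = a M]; comparing
    it with the prescribed gap decides whether the excess mass must condense.

    In the interior, [theta = x (1 - omega) + y (omega - a)] with [x, y > 0], and
    the unknowns [x], [y] are found by two nested applications of the
    intermediate value theorem.  The moments of [1 - omega] and [omega - a] are
    used instead of mass and energy because [(1 - omega) bose theta <= 1 / x]:
    dominated convergence then holds up to the edge [y = 0] whether or not
    [1 / (1 - omega)] is integrable, and likewise for the other edge. *)

(** * The Bose function and the entropy *)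

(** On reals [0^-1 = 0], so [bose 0 = 0], whereas [bose_einstein] is [+oo] where [theta] vanishes.
    The two differ only on a null set: a nonnegative, nontrivial [theta] is affine in [omega], so it
    can vanish only on the extreme level sets of [omega]. The estimates therefore concern real
    functions, with a null set removed wherever the convention would spoil a lower bound.

    Most of them come from the squeeze [e^-x <= x bose x <= 1]. At [x = t s], as [t] tends to 0, it
    sends [t] times the mass to [\int 1 / s] and [t] times the gap to the volume; the quotient of
    these limits is the constant in [alpha] and [beta]. For large [t] the function [bose (t s)]
    concentrates where [s] is small, so the gap is negligible against the mass; hence the slopes 1
    and [a] at zero mass.

    That [f_- <= f_+] is a correlation inequality: the line through the origin whose slope is the
    mean of [omega] separates the curves. When [a = 0] and [1 / omega] is not integrable, [f_-] is
    identically 0, which is why it is nondecreasing in general and increasing only under a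
    condition. *)

Section bose.
Variable R : realType.
Implicit Types x y : R.

Definition bose x : R := (expR x - 1)^-1.

Lemma bose0 : bose 0 = 0.
Proof. by rewrite /bose expR0 subrr invr0. Qed.

Lemma bose_gt0 x : 0 < x -> 0 < bose x.
Proof. by move=> x0; rewrite invr_gt0 subr_gt0 expR_gt1. Qed.

Lemma bose_ge0 x : 0 <= x -> 0 <= bose x.
Proof. by rewrite le_eqVlt => /predU1P[<-|/bose_gt0/ltW//]; rewrite bose0. Qed.

Lemma bose_lt x y : 0 < x -> x < y -> bose y < bose x.
Proof.
move=> x0 xy; rewrite ltf_pV2 ?posrE ?subr_gt0 ?expR_gt1//.
  by rewrite ltrBlDr subrK ltr_expR.
exact: lt_trans xy.
Qed.

Lemma bose_le x y : 0 < x -> x <= y -> bose y <= bose x.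
Proof.
by move=> x0; rewrite le_eqVlt => /predU1P[->//|xy]; exact/ltW/bose_lt.
Qed.

Lemma mul_bose_le1 x : 0 <= x -> x * bose x <= 1.
Proof.
rewrite le_eqVlt => /predU1P[<-|x0]; first by rewrite mul0r.
by rewrite ler_pdivrMr ?subr_gt0 ?expR_gt1// mul1r lerBrDl expR_ge1Dx.
Qed.

Lemma bose_le_inv x : 0 <= x -> bose x <= x^-1.
Proof.
rewrite le_eqVlt => /predU1P[<-|x0]; first by rewrite bose0 invr0.
by rewrite -[leRHS]mul1r ler_pdivlMr// mulrC mul_bose_le1// ltW.
Qed.

(** Multiplied by [e^x - 1], this reads [1 - e^-x <= x]. It fails at [x = 0], where [bose 0 = 0] by
    convention. *)
Lemma expRN_le_mul_bose x : 0 < x -> expR (- x) <= x * bose x.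
Proof.
move=> x0; rewrite ler_pdivlMr ?subr_gt0 ?expR_gt1// mulrBr -expRD addNr expR0.
by rewrite mulr1 lerBlDl -lerBlDr expR_ge1Dx.
Qed.

(* [bose (2 x) / bose x = 1 / (e ^ x + 1)] *)
Lemma bose_double x : 0 < x -> x * bose (2 * x) <= bose x.
Proof.
move=> x0; have e1 : 0 < expR x - 1 by rewrite subr_gt0 expR_gt1.
rewrite /bose mulr_natl mulr2n expRD.
have -> : expR x * expR x - 1 = (expR x - 1) * (expR x + 1) by ring.
rewrite invfM mulrCA ger_pMr ?invr_gt0//.
have e2 : 0 < expR x + 1 by rewrite addr_gt0// expR_gt0.
rewrite ler_pdivrMr// mul1r (le_trans (ltW (lt_le_trans _ (expR_ge1Dx x))))//.
  by rewrite ltrDr.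
by rewrite lerDl.
Qed.

Lemma is_derive_bose x : 0 < x ->
  is_derive x 1 bose (- (bose x * (1 + bose x))).
Proof.
move=> x0; have e1 : expR x - 1 != 0 by rewrite subr_eq0 gt_eqF// expR_gt1.
have de : is_derive x 1 (fun y => expR y - 1) (expR x).
  by rewrite -[X in is_derive _ _ _ X]subr0; apply: is_deriveB.
have dV : derivable (fun y => expR y - 1) x 1 by [].
apply: DeriveDef; first exact: derivableV.
rewrite deriveV// (@derive_val _ _ _ _ _ _ _ de) /bose scaleNr.
by rewrite [_ *: _]mulrC; field; exact: e1.
Qed.

Lemma continuous_bose x : 0 < x -> {for x, continuous bose}.
Proof.
move=> x0; apply/differentiable_continuous/derivable1_diffP.
by have [] := is_derive_bose x0.
Qed.

Lemma measurable_invr : measurable_fun [set: R] (@GRing.inv R).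
Proof.
have -> : [set: R] = [set~ 0] `|` [set 0] by rewrite setUC setUv.
apply/measurable_funU => //; first exact: measurableC.
split; last exact: measurable_fun_set1.
apply: open_continuous_measurable_fun; first by apply: closed_openC; exact: closed_eq.
by move=> x /set_mem/eqP x0; exact: inv_continuous.
Qed.

Lemma measurable_bose : measurable_fun [set: R] bose.
Proof.
apply: (measurableT_comp measurable_invr).
by apply: measurable_funB => //; exact: measurable_expR.
Qed.

End bose.

Section entropy_tangent.
Variable R : realType.
Implicit Types x t : R.

Lemma ln_lt_sub1 x : 0 < x -> x != 1 -> ln x < x - 1.
Proof.
move=> x0 x1; rewrite -{2}(@lnK _ x)// ltrBrDl expR_gt1Dx//.
by rewrite ln_eq0.
Qed.

Lemma ln_le_sub1 x : 0 < x -> ln x <= x - 1.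
Proof. by move=> x0; rewrite -{1}(subrK 1 x) addrC le_ln1Dx// ltrBrDl subrr. Qed.

(* [ln (1 + bose t)] is the Legendre transform of the entropy at slope [t]. *)
Lemma bose_entropy_tangent x t : 0 <= x -> 0 < t ->
  bose_entropy x <= t * x + ln (1 + bose t) ?= iff (x == bose t).
Proof.
move=> x0 t0; have b0 := bose_gt0 t0; set b := bose t in b0 *.
have b1 : 0 < 1 + b by rewrite addr_gt0.
have x1 : 0 < 1 + x by rewrite ltr_wpDr.
have tE : t = ln (1 + b) - ln b.
  rewrite -ln_div ?posrE//; apply/expR_inj; rewrite lnK ?posrE ?divr_gt0//.
  have e1 : expR t - 1 != 0 by rewrite subr_eq0 gt_eqF// expR_gt1.
  by rewrite /b /bose; field.
have [->|xn0] := eqVneq x 0.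
  have l0 : 0 < ln (1 + b) by rewrite ln_gt0// ltrDl.
  rewrite /bose_entropy addr0 ln1 !mulr0 mul0r subr0 add0r; split.
    exact: ltW.
  by rewrite !lt_eqF.
have {}x0 : 0 < x by rewrite lt_neqAle eq_sym xn0.
(* With [u] and [v] the two arguments of [ln], the deficit is [- (x ln u + ln v)], and [F] below
   says [x (u - 1) + (v - 1) = 0]. So [ln r <= r - 1] gives the sign, and its strictness at [v]
   gives the equality case. *)
have E : t * x + ln (1 + b) - bose_entropy x =
    - (x * ln (b * (1 + x) / (x * (1 + b))) + ln ((1 + x) / (1 + b))).
  rewrite /bose_entropy tE !ln_div ?posrE ?mulr_gt0// !lnM ?posrE//; ring.
have F : x * (b * (1 + x) / (x * (1 + b)) - 1) + ((1 + x) / (1 + b) - 1) = 0.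
  by field; rewrite !gt_eqF.
split.
  rewrite -subr_ge0 E oppr_ge0 -F lerD//.
    by rewrite ler_pM2l// ln_le_sub1// divr_gt0// mulr_gt0.
  by rewrite ln_le_sub1// divr_gt0.
rewrite eq_sym -subr_eq0 E oppr_eq0; apply/eqP/eqP => [|xb]; last first.
  have -> : b * (1 + x) / (x * (1 + b)) = 1.
    by rewrite -xb divff// mulf_neq0// gt_eqF.
  by rewrite xb divff ?gt_eqF// ln1 mulr0 addr0.
move=> G; apply/eqP; apply: contraTT isT => xb.
suff : x * ln (b * (1 + x) / (x * (1 + b))) + ln ((1 + x) / (1 + b)) < 0.
  by rewrite G ltxx.
rewrite -F ler_ltD//.
  by rewrite ler_pM2l// ln_le_sub1// divr_gt0// mulr_gt0.
rewrite ln_lt_sub1 ?divr_gt0//; apply: contra xb => /eqP/divr1_eq/addrI ->.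
by [].
Qed.

Lemma bose_entropy_gt0 x : 0 < x -> 0 < bose_entropy x.
Proof.
move=> x0; rewrite /bose_entropy mulrDl mul1r -addrA -mulrBr addr_gt0//.
  by rewrite ln_gt0// ltrDl.
by rewrite mulr_gt0// subr_gt0 ltr_ln ?posrE ?ltrDr// addr_gt0.
Qed.

Lemma bose_entropy_ge0 x : 0 <= x -> 0 <= bose_entropy x.
Proof.
rewrite le_eqVlt => /predU1P[<-|/bose_entropy_gt0/ltW//].
by rewrite /bose_entropy addr0 ln1 !mulr0 mul0r subr0.
Qed.

Lemma measurable_bose_entropy : measurable_fun [set: R] (@bose_entropy R).
Proof.
apply: measurable_funB; apply: measurable_funM => //.
  exact: measurable_funD.
by apply: measurableT_comp => //; exact: measurable_funD.
Qed.

End entropy_tangent.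

(** * Weighted Bose integrals *)

Lemma IVT_nonincreasing (R : realType) (f : R -> R) (a b v : R) : a <= b ->
  {within `[a, b], continuous f} -> f b <= v -> v <= f a ->
  exists2 c, a <= c <= b & f c = v.
Proof.
move=> ab cf fb fa; have [|c cab fc] := @IVT _ f a b v ab cf.
  by rewrite ge_min fb orbT le_max fa.
by exists c => //; move: cab; rewrite in_itv.
Qed.

Section measure_preliminaries.
Context d (T : measurableType d) (R : realType).
Variable mu : {measure set T -> \bar R}.
Implicit Types f : T -> R.

Lemma measurable_level f (x : R) : measurable_fun setT f ->
  measurable [set p | f p = x].
Proof.
by move=> mf; rewrite -[X in measurable X]setTI; exact: (mf measurableT [set x]).
Qed.

Lemma measurable_sublevel f (x : R) : measurable_fun setT f ->
  measurable [set p | f p < x].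
Proof.
move=> mf; rewrite -[X in measurable X]setTI (_ : mkset _ = f @^-1` `]-oo, x[%classic).
  exact: (mf measurableT _ (measurable_itv _)).
by apply/seteqP; split => p; rewrite /= in_itv.
Qed.

Lemma measureU_null (A B : set T) : measurable A -> measurable B ->
  mu A = 0%E -> mu B = 0%E -> mu (A `|` B) = 0%E.
Proof.
move=> mA mB A0 B0; apply/eqP; rewrite -measure_le0.
apply: (le_trans (measureU2 _ mA mB)).
by rewrite [X in (X + _)%E]A0 [X in (_ + X)%E]B0 adde0.
Qed.

Lemma ge0_integrable_fin f :
  measurable_fun setT f -> (forall p, 0 <= f p) ->
  (\int[mu]_p (f p)%:E < +oo)%E -> mu.-integrable setT (EFin \o f).
Proof.
move=> mf f0 fy; apply/integrableP; split; first exact/measurable_EFinP.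
by under eq_integral do rewrite gee0_abs ?lee_fin//.
Qed.

Lemma integral_lincomb f1 f2 (u v : R) :
  mu.-integrable setT (EFin \o f1) -> mu.-integrable setT (EFin \o f2) ->
  (\int[mu]_p (u * f1 p + v * f2 p)%:E)%E =
  (u * \int[mu]_p f1 p + v * \int[mu]_p f2 p)%:E.
Proof.
move=> I1 I2; have J1 := integrableZl measurableT u I1.
have J2 := integrableZl measurableT v I2.
rewrite -RintegralZl// -RintegralZl// -RintegralD// fineK//.
apply: integrable_fin_num => //.
by have := integrableD measurableT J1 J2; apply: eq_integrable.
Qed.

End measure_preliminaries.

Section weighted_bose_integral.
Context d (T : measurableType d) (R : realType).
Variable mu : {measure set T -> \bar R}.
Hypothesis muT_gt0 : (0 < mu setT)%E.
Hypothesis muT_lty : (mu setT < +oo)%E.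

Lemma bounded_integrable (f : T -> R) (c : R) : measurable_fun setT f ->
  (forall p, 0 <= f p <= c) -> mu.-integrable setT (EFin \o f).
Proof.
move=> mf fc; apply: measurable_bounded_integrable => //.
exists c; split; first exact: num_real.
move=> M cM p _; have /andP[f0 fpc] := fc p.
by rewrite /= ger0_norm// (le_trans fpc (ltW cM)).
Qed.

(** Otherwise the nonnegative difference has integral zero, hence vanishes off a null set [Z]; then
    [N] and [Z] cover the space, against [muT_gt0]. *)
Lemma lt_Rintegral (N : set T) (f g : T -> R) : mu N = 0%E ->
  mu.-integrable setT (EFin \o f) -> mu.-integrable setT (EFin \o g) ->
  measurable N ->
  (forall p, f p <= g p) -> (forall p, ~ N p -> f p < g p) ->
  \int[mu]_p f p < \int[mu]_p g p.
Proof.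
move=> N0 If Ig mN fg fgN; rewrite -subr_gt0 -RintegralB// lt_neqAle.
rewrite Rintegral_ge0 ?andbT; last by move=> p _; rewrite subr_ge0.
apply/negP => /eqP/esym I0.
have Igf : mu.-integrable setT (EFin \o (fun p => g p - f p)).
  rewrite (_ : _ \o _ = ((EFin \o g) \- (EFin \o f))%E)//.
  exact: integrableB.
have : (\int[mu]_p `|(EFin \o (fun p => (g p - f p)%R)) p|)%E = 0%E.
  transitivity (\int[mu]_p (g p - f p)%:E)%E.
    by apply: eq_integral => p _; rewrite gee0_abs ?lee_fin ?subr_ge0.
  rewrite -[LHS](fineK (integrable_fin_num measurableT Igf)).
  by congr EFin.
move/ae_eq_integral_abs => /(_ measurableT (measurable_int _ Igf)).
move=> [Z [mZ Z0 Zsub]].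
suff : mu setT = 0%E by move=> E; move: muT_gt0; rewrite E ltxx.
have : mu (N `|` Z) = 0%E by exact: measureU_null.
apply: subset_measure0 => //; first exact: measurableU.
move=> p _; have [Np|Np] := pselect (N p); [by left|right].
apply: Zsub => /= /(_ I)/= [] /eqP; rewrite subr_eq0 => /eqP gf.
by have := fgN _ Np; rewrite gf ltxx.
Qed.

Implicit Types s : T -> R.

(** The weight [s1] is the summand that [x] multiplies in [theta = x s1 + y s2]. The other moment is
    [wint s2 s1 y x], so that each lemma about one moment serves both. *)
Definition wint s1 s2 (x y : R) : R :=
  \int[mu]_p (s1 p * bose (x * s1 p + y * s2 p)).

Lemma measurable_wbose s1 s2 s x y : measurable_fun setT s1 ->
  measurable_fun setT s2 -> measurable_fun setT s ->
  measurable_fun setT (fun p => s p * bose (x * s1 p + y * s2 p)).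
Proof.
move=> m1 m2 m; apply: measurable_funM => //.
apply: measurableT_comp; first exact: measurable_bose.
by apply: measurable_funD; apply: measurable_funM.
Qed.

Section bounds.
Variables s1 s2 : T -> R.
Hypotheses (m1 : measurable_fun setT s1) (m2 : measurable_fun setT s2).
Hypotheses (s1_ge0 : forall p, 0 <= s1 p) (s2_ge0 : forall p, 0 <= s2 p).
Hypothesis s10 : mu [set p | s1 p = 0] = 0%E.

Lemma wbose_bound x y p : 0 < x -> 0 <= y ->
  0 <= s1 p * bose (x * s1 p + y * s2 p) <= x^-1.
Proof.
move=> x0 y0; have := s1_ge0 p; rewrite le_eqVlt => /predU1P[<-|sp].
  by rewrite mul0r lexx invr_ge0 ltW.
have xs0 : 0 < x * s1 p by rewrite mulr_gt0.
have t0 : 0 < x * s1 p + y * s2 p by rewrite ltr_wpDr// mulr_ge0.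
apply/andP; split; first by rewrite mulr_ge0// bose_ge0// ltW.
have -> : x^-1 = s1 p * (x * s1 p)^-1 by field; rewrite !gt_eqF.
rewrite ler_pM2l// (le_trans (bose_le_inv (ltW t0)))// lef_pV2// ?posrE//.
by rewrite lerDl mulr_ge0.
Qed.

Lemma integrable_wbose x y : 0 < x -> 0 <= y ->
  mu.-integrable setT (EFin \o (fun p => s1 p * bose (x * s1 p + y * s2 p))).
Proof.
move=> x0 y0; apply: (@bounded_integrable _ x^-1).
  exact: measurable_wbose.
by move=> p; exact: wbose_bound.
Qed.

Lemma wint_le_inv x y : 0 < x -> 0 <= y ->
  wint s1 s2 x y <= x^-1 * fine (mu setT).
Proof.
move=> x0 y0; rewrite -Rintegral_cst//; apply: le_Rintegral => //.
- exact: integrable_wbose.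
- by apply: (@bounded_integrable _ x^-1) => // p; rewrite lexx andbT invr_ge0 ltW.
- by move=> p _; have /andP[] := wbose_bound p x0 y0.
Qed.

Lemma le_wbose x x' y y' p : 0 < x -> 0 <= y -> x <= x' -> y <= y' ->
  s1 p * bose (x' * s1 p + y' * s2 p) <= s1 p * bose (x * s1 p + y * s2 p).
Proof.
move=> x0 y0 xx yy; have := s1_ge0 p; rewrite le_eqVlt => /predU1P[<-|sp].
  by rewrite !mul0r.
rewrite ler_wpM2l// bose_le//.
  by rewrite ltr_wpDr ?mulr_ge0// mulr_gt0.
by rewrite lerD// ler_wpM2r.
Qed.

Lemma le_wint x x' y y' : 0 < x -> 0 <= y -> x <= x' -> y <= y' ->
  wint s1 s2 x' y' <= wint s1 s2 x y.
Proof.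
move=> x0 y0 xx yy; apply: le_Rintegral => //.
- by apply: integrable_wbose; [exact: lt_le_trans xx|exact: le_trans yy].
- exact: integrable_wbose.
- by move=> p _; exact: le_wbose.
Qed.

Lemma lt_wint x x' y : 0 < x -> 0 <= y -> x < x' ->
  wint s1 s2 x' y < wint s1 s2 x y.
Proof.
move=> x0 y0 xx; apply: (@lt_Rintegral [set p | s1 p = 0]) => //.
- by apply: integrable_wbose => //; exact: lt_trans xx.
- exact: integrable_wbose.
- exact: measurable_level.
- by move=> p; apply: le_wbose => //; exact: ltW.
move=> p /= /eqP sn0; have sp : 0 < s1 p by rewrite lt_neqAle eq_sym sn0 s1_ge0.
rewrite ltr_pM2l// bose_lt//.
  by rewrite ltr_wpDr ?mulr_ge0// mulr_gt0.
by rewrite ltrD2r ltr_pM2r.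
Qed.

(** Both parameters may move with [l], since the outer intermediate value argument runs along a
    curve [(X y, y)]. The lower bound [c] on the first one provides the dominating constant
    [c^-1]. *)
Lemma continuous_wint (u v c : R) (X Y : R -> R) : 0 < c ->
  {in `]u, v[%classic, continuous X} -> {in `]u, v[%classic, continuous Y} ->
  (forall l, `]u, v[%classic l -> c <= X l /\ 0 <= Y l) ->
  {in `]u, v[%classic, continuous (fun l => wint s1 s2 (X l) (Y l))}.
Proof.
move=> c0 cX cY XY.
apply: (@continuity_under_integral _ _ _ mu _ setT _ u v _ _ (cst c^-1)) => //.
- by move=> l /XY[cl l0]; apply: integrable_wbose => //; exact: lt_le_trans cl.
- apply: aeW => p _ l Il; have [cl l0] := XY _ (set_mem Il).
  have := s1_ge0 p; rewrite le_eqVlt => /predU1P[s0|sp].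
    by rewrite -s0; under eq_fun do rewrite mul0r; exact: cst_continuous.
  apply: cvgM; first exact: cvg_cst.
  have t0 : 0 < X l * s1 p + Y l * s2 p.
    by rewrite ltr_wpDr ?mulr_ge0// mulr_gt0// (lt_le_trans c0).
  apply: (continuous_comp (f := fun l => X l * s1 p + Y l * s2 p)).
    by apply: cvgD; (apply: cvgM; last exact: cvg_cst); [exact: cX|exact: cY].
  exact: continuous_bose.
- by apply: (@bounded_integrable _ c^-1) => // p; rewrite /= lexx andbT invr_ge0 ltW.
- move=> l /XY[cl l0]; apply: aeW => p _ /=.
  have X0 : 0 < X l by exact: lt_le_trans cl.
  have /andP[w0 w1] := wbose_bound p X0 l0.
  by rewrite ger0_norm// (le_trans w1)// lef_pV2 ?posrE.
Qed.

End bounds.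

(* Approaching an edge of the quadrant the integrals increase to their values
   on the edge, be they finite or not. *)
Lemma wint_edge s1 s2 x (q : R) : measurable_fun setT s1 ->
  measurable_fun setT s2 ->
  (forall p, 0 <= s1 p) -> (forall p, 0 <= s2 p) -> 0 < x ->
  (q%:E < \int[mu]_p (s2 p * bose (x * s1 p))%:E)%E ->
  exists2 y, 0 < y & q < wint s2 s1 y x.
Proof.
move=> m1 m2 s1_ge0 s2_ge0 x0; apply: contraPP => /forall2NP H; apply/negP.
rewrite -leNgt.
(* Contrapositive: if every interior value is at most [q], then Fatou's lemma along
   [y = 1 / (n + 1)] bounds the edge integral by [q]. *)
pose f n p : \bar R := (s2 p * bose (n.+1%:R^-1 * s2 p + x * s1 p))%:E.
have mf n : measurable_fun setT (f n).
  by apply/measurable_EFinP; exact: measurable_wbose.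
have n0 n : 0 < n.+1%:R^-1 :> R by rewrite invr_gt0.
have f0 n p : (0 <= f n p)%E.
  by rewrite lee_fin; have /andP[] := wbose_bound s2_ge0 s1_ge0 p (n0 n) (ltW x0).
have If n : (\int[mu]_p f n p <= q%:E)%E.
  have [/(_ (n0 n))//|/negP] := H n.+1%:R^-1; rewrite -leNgt => h.
  rewrite -(fineK (integrable_fin_num measurableT _)) ?lee_fin//.
  exact: integrable_wbose s2_ge0 s1_ge0 _ _ (n0 n) (ltW x0).
have := @fatou _ _ _ mu _ measurableT f mf (fun n p _ => f0 n p).
have einf0 p : (0 <= limn_einf (f ^~ p))%E.
  rewrite limn_einf_lim; apply: lime_ge; first exact: is_cvg_einfs.
  by apply: nearW => n; apply: le_ereal_inf_tmp => _ [m _ <-]; exact: f0.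
move=> fat; apply: le_trans (le_trans _ fat) _; last first.
  rewrite limn_einf_lim; apply: lime_le; first exact: is_cvg_einfs.
  by apply: nearW => n; apply: le_trans (If n); apply: ereal_inf_lbound; exists n => //=.
apply: ge0_le_integral => //.
- by move=> p _; rewrite lee_fin mulr_ge0// bose_ge0// mulr_ge0// ltW.
- apply/measurable_EFinP; apply: measurable_funM => //.
  by apply: measurableT_comp; [exact: measurable_bose|exact: measurable_funM].
- apply: (measurableT_comp (f := -%E) (g := fun p => limn_esup (\- f ^~ p)%E)) => //.
  by apply: measurable_fun_limn_esup => n; exact: measurableT_comp (mf n).
(* Where [s1 p = 0] the edge integrand is 0 by [bose0], and nonnegativity of the lower limit is
   enough. *)
move=> p _; have := s1_ge0 p; rewrite le_eqVlt => /predU1P[s0|sp].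
  rewrite -s0 mulr0 bose0 mulr0.
  exact: einf0.
have /cvg_limn_einf_sup[-> _ //] : f ^~ p @ \oo --> (s2 p * bose (x * s1 p))%:E.
apply/cvg_EFin; first exact: nearW.
apply: cvgM; first exact: cvg_cst.
have xs0 : 0 < x * s1 p by rewrite mulr_gt0.
apply: (continuous_cvg _ (continuous_bose xs0)).
rewrite -[X in _ --> X]add0r; apply: cvgD; last exact: cvg_cst.
rewrite -(mul0r (s2 p)); apply: cvgM; last exact: cvg_cst.
exact: cvg_harmonic.
Qed.

End weighted_bose_integral.

(** * Solving for two prescribed moments *)

Section two_parameters.
Context d (T : measurableType d) (R : realType).
Variable mu : {measure set T -> \bar R}.
Hypothesis muT_gt0 : (0 < mu setT)%E.
Hypothesis muT_lty : (mu setT < +oo)%E.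
Variables s1 s2 : T -> R.
Hypotheses (m1 : measurable_fun setT s1) (m2 : measurable_fun setT s2).
Hypotheses (s1_ge0 : forall p, 0 <= s1 p) (s2_ge0 : forall p, 0 <= s2 p).
Hypothesis s10 : mu [set p | s1 p = 0] = 0%E.

Local Notation W := (wint mu s1 s2).
Local Notation W' := (wint mu s2 s1).

Let W_le x x' y y' : 0 < x -> 0 <= y -> x <= x' -> y <= y' -> W x' y' <= W x y.
Proof. exact: le_wint. Qed.

Let W_lt x x' y : 0 < x -> 0 <= y -> x < x' -> W x' y < W x y.
Proof. exact: lt_wint. Qed.

Let W'_le x x' y y' : 0 < y -> 0 <= x -> x <= x' -> y <= y' -> W' y' x' <= W' y x.
Proof. by move=> *; exact: le_wint. Qed.

Lemma wint_solve x y p0 : 0 < x -> 0 <= y -> 0 < p0 -> p0 <= W x y ->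
  exists2 x', x <= x' & W x' y = p0.
Proof.
(* At the right endpoint [B] the moment is at most [V / B], which is below [p0] because
   [B > V / p0]. *)
move=> x0 y0 p00 px; pose V := fine (mu setT); pose B := x + V / p0.
have V0 : 0 < V by apply: fine_gt0; rewrite muT_gt0 muT_lty.
have xB : x < B by rewrite ltrDl divr_gt0.
have B0 : 0 < B by exact: lt_trans xB.
have WB : W B y < p0.
  apply: le_lt_trans (wint_le_inv muT_lty m1 m2 s1_ge0 s2_ge0 B0 y0) _.
  rewrite mulrC ltr_pdivrMr// /B mulrDr mulrCA divff ?gt_eqF// mulr1.
  by rewrite ltrDr mulr_gt0.
have [|x' /andP[xx _] Wx] := @IVT_nonincreasing _ (W ^~ y) _ _ _ (ltW xB) _ (ltW WB) px.
  apply: continuous_in_subspaceT => z /set_mem/=; rewrite in_itv/= => /andP[xz zB].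
  apply: (@continuous_wint _ _ _ _ muT_lty _ _ m1 m2 s1_ge0 s2_ge0 (x / 2) (B + 1)
    (x / 2) id (cst y)) => //.
  + by rewrite divr_gt0.
  + by move=> ? _; exact: cvg_id.
  + by move=> ? _; exact: cst_continuous.
  + by move=> l /=; rewrite in_itv/= => /andP[/ltW ->].
  + rewrite inE/= in_itv/= ltr_pdivrMr// mulr_natr mulr2n.
    by rewrite (le_lt_trans xz) ?ltrDl ?(lt_le_trans x0)//= ltr_pwDr.
by exists x'.
Qed.

Let W_cont x v : 0 < x -> {in `]0, v[%classic, continuous (W x)}.
Proof.
move=> x0; apply: (@continuous_wint _ _ _ _ muT_lty _ _ m1 m2 s1_ge0 s2_ge0 0 v
    x (cst x) id) => //.
- by move=> ? _; exact: cst_continuous.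
- by move=> ? _; exact: cvg_id.
- by move=> l /=; rewrite in_itv/= => /andP[/ltW].
Qed.

(** Both moments are nonincreasing in each parameter. Follow the level curve [W (X y) y = p0]. At a
    small [y1] one has [X y1 <= X0], so the second moment is at least [W' y1 X0 > q0]; at [Y0] it is
    at most its edge value [W' Y0 0 = q0]. It takes the value [q0] in between. *)
Lemma two_parameter_solution p0 q0 X0 Y0 : 0 < p0 -> 0 < X0 -> 0 < Y0 ->
  W X0 0 = p0 -> (q0%:E < \int[mu]_p (s2 p * bose (X0 * s1 p))%:E)%E ->
  W' Y0 0 = q0 -> (p0%:E < \int[mu]_p (s1 p * bose (Y0 * s2 p))%:E)%E ->
  exists x y, [/\ 0 < x, 0 < y, W x y = p0 & W' y x = q0].
Proof.
move=> p00 X00 Y00 WX0 /wint_edge[]// y1 y10 qy1 WY0 /wint_edge[]// x1 x10 px1.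
have y1Y0 : y1 < Y0.
  rewrite ltNge; apply/negP => Y0y1.
  have := W'_le Y00 (lexx 0) (ltW X00) Y0y1.
  by rewrite WY0 leNgt qy1.
(* The level curve is continued slightly past [Y0], so that [Y0] is interior to the open interval on
   which [X] is continuous. *)
have [Y1 Y01 pY1] : exists2 Y1, Y0 < Y1 & p0 < W x1 Y1.
  have /cvgr_gt : W x1 y @[y --> Y0] --> W x1 Y0.
    apply: (W_cont (v := Y0 + 1)) => //.
    by rewrite inE/= in_itv/= Y00 ltrDl ltr01.
  move=> /(_ _ px1)/nbhs_ballP[e/= e0 He].
  exists (Y0 + e / 2); first by rewrite ltrDl divr_gt0.
  apply: He; rewrite /ball/= opprD addrA subrr add0r normrN gtr0_norm ?divr_gt0//.
  by rewrite ltr_pdivrMr// mulr_natr mulr2n ltrDl.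
have Y10 : 0 < Y1 by exact: lt_trans Y01.
(* Since [p0 < W x1 y] for all [y] up to [Y1], the solution lies to the right of [x1]; this keeps
   [X] away from 0. Outside the interval the value is arbitrary. *)
have /choice[X XP] : forall y, exists x,
    0 < y < Y1 -> x1 < x /\ W x y = p0.
  move=> y; have [/andP[y0 yY]|_] := boolP (0 < y < Y1); last by exists 0.
  have pW : p0 < W x1 y.
    exact: lt_le_trans pY1 (W_le x10 (ltW y0) (lexx x1) (ltW yY)).
  have [x x1x Wx] := wint_solve x10 (ltW y0) p00 (ltW pW).
  exists x => _; split => //; rewrite lt_neqAle x1x andbT.
  by apply: contraTN pW => /eqP ->; rewrite Wx ltxx.
(* Strict monotonicity in the first parameter puts [p0] strictly between the values of [W] at
   [X y - e'] and [X y + e']. By continuity in the second parameter this persists for [z] near [y],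
   which traps [X z]. Taking [e' <= X y - x1] keeps the left point positive. *)
have cX : {in `]0, Y1[%classic, continuous X}.
  move=> y yI; have yI' : 0 < y < Y1 by move: yI; rewrite inE/= in_itv.
  have /andP[y0 _] := yI'; have [x1y Wy] := XP _ yI'.
  apply/cvgrPdist_lt => e e0.
  pose e' := Num.min e (X y - x1).
  have e'0 : 0 < e' by rewrite lt_min e0 subr_gt0.
  have xl : x1 <= X y - e' by rewrite lerBrDl -lerBrDr ge_min lexx orbT.
  have xl0 : 0 < X y - e' by exact: lt_le_trans xl.
  have Xy0 : 0 < X y by exact: lt_trans x1y.
  have Wl : p0 < W (X y - e') y by rewrite -Wy W_lt// ?ltW// ltrBlDr ltrDl.
  have Wr : W (X y + e') y < p0 by rewrite -Wy W_lt// ?ltW// ltrDl.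
  have := W_cont (v := Y1) xl0 yI; move/cvgr_gt => /(_ _ Wl) nl.
  have := W_cont (v := Y1) (addr_gt0 Xy0 e'0) yI; move/cvgr_lt => /(_ _ Wr) nr.
  near=> z.
  have zI : 0 < z < Y1.
    suff : z \in `]0, Y1[ by rewrite in_itv.
    by near: z; apply: near_in_itvoo; rewrite in_itv.
  have /andP[z0 _] := zI; have [x1z Wz] := XP _ zI.
  have Xz0 : 0 < X z by exact: lt_trans x1z.
  rewrite (@lt_le_trans _ _ e')//; last by rewrite ge_min lexx.
  rewrite distrC ltr_distl; apply/andP; split; rewrite ltNge; apply/negP => Xz.
  - have : p0 < W (X y - e') z by near: z.
    by apply/negP; rewrite -leNgt -Wz W_le// ltW.
  - have : W (X y + e') z < p0 by near: z.
    by apply/negP; rewrite -leNgt -Wz W_le// ?ltW// addr_gt0.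
have y1I : 0 < y1 < Y1 by rewrite y10 (lt_trans y1Y0).
have Y0I : 0 < Y0 < Y1 by rewrite Y00.
have [x1y1 Wy1] := XP _ y1I; have [x1Y0 WY0'] := XP _ Y0I.
have Xy1 : X y1 <= X0.
  rewrite leNgt; apply/negP => /(W_lt X00 (ltW y10)); rewrite Wy1.
  by rewrite ltNge -WX0 W_le// ltW.
have Gy1 : q0 <= W' y1 (X y1).
  have X10 : 0 <= X y1 by exact/ltW/(lt_trans x10).
  exact: le_trans (ltW qy1) (W'_le y10 X10 Xy1 (lexx y1)).
have GY0 : W' Y0 (X Y0) <= q0.
  rewrite -WY0; have X10 : 0 <= X Y0 by exact/ltW/(lt_trans x10).
  exact: W'_le Y00 (lexx 0) X10 (lexx Y0).
have [|y /andP[y1y yY0] Wy] :=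
    @IVT_nonincreasing _ (fun y => W' y (X y)) y1 Y0 q0 (ltW y1Y0) _ GY0 Gy1.
  apply: continuous_in_subspaceT => z /set_mem/=; rewrite in_itv/= => /andP[yz zY].
  have hy1 : 0 < y1 / 2 by rewrite divr_gt0.
  apply: (@continuous_wint _ _ _ _ muT_lty _ _ m2 m1 s2_ge0 s1_ge0 (y1 / 2) Y1
    (y1 / 2) id X) => //.
  + by move=> ? _; exact: cvg_id.
  + move=> l; rewrite inE/= in_itv/= => /andP[l0 lY]; apply: cX.
    by rewrite inE/= in_itv/= lY (lt_trans hy1).
  + move=> l /=; rewrite in_itv/= => /andP[l0 lY]; split; first exact: ltW.
    by have [|+ _] := XP l; rewrite ?lY ?(lt_trans hy1) ?andbT//;
      move=> ?; rewrite ltW// (lt_trans x10).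
  + rewrite inE/= in_itv/= (le_lt_trans zY)// andbT (lt_le_trans _ yz)//.
    by rewrite ltr_pdivrMr// mulr_natr mulr2n ltrDl.
have yI : 0 < y < Y1 by rewrite (lt_le_trans y10)//= (le_lt_trans yY0).
have [x1y Wxy] := XP _ yI.
exists (X y), y; split => //; first exact: lt_trans x1y.
by case/andP: yI.
Unshelve. all: end_near. Qed.

End two_parameters.

(** * The gap function of a boundary curve *)

Section gap.
Context d (T : measurableType d) (R : realType).
Variable mu : {measure set T -> \bar R}.
Implicit Types (s w : T -> R) (t m : R).

Definition bose_int w s t : R := \int[mu]_p (w p * bose (t * s p)).

Definition bose_mass s t : R := bose_int (cst 1) s t.
Definition bose_gap s t : R := bose_int s s t.

Definition mass_inv s m : R := xget 0 [set t | 0 < t /\ bose_mass s t = m].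

(* The value of [bose_gap] as a function of the mass along the curve
   [t |-> bose (t * s)], which is degenerate when [1 / s] is not integrable. *)
Definition gap s m : R :=
  if (0 < m) && `[< mu.-integrable setT (EFin \o (fun p => (s p)^-1)) >]
  then bose_gap s (mass_inv s m) else 0.

Hypothesis muT_gt0 : (0 < mu setT)%E.
Hypothesis muT_lty : (mu setT < +oo)%E.

Local Notation V := (fine (mu setT)).

Let V_gt0 : 0 < V.
Proof. by apply: fine_gt0; rewrite muT_gt0 muT_lty. Qed.

Lemma integrable_cstr (c : R) : mu.-integrable setT (EFin \o (fun _ : T => c)).
Proof.
have [c0|c0] := leP 0 c.
  by apply: (bounded_integrable muT_lty (c := c)) => // p; rewrite c0 lexx.
rewrite (_ : _ \o _ = (-%E \o (EFin \o (fun=> - c)))); last first.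
  by apply/funext => p /=; rewrite opprK.
apply: integrableN => //; apply: (bounded_integrable muT_lty (c := - c)) => // p.
by rewrite lexx andbT oppr_ge0 ltW.
Qed.

Lemma le_Rintegral_off (N : set T) (f g : T -> R) : measurable N -> mu N = 0%E ->
  mu.-integrable setT (EFin \o f) -> mu.-integrable setT (EFin \o g) ->
  (forall p, ~ N p -> f p <= g p) -> \int[mu]_p f p <= \int[mu]_p g p.
Proof.
move=> mN N0 If Ig fg; rewrite /Rintegral (negligible_integral mN measurableT If N0).
rewrite (negligible_integral mN measurableT Ig N0).
apply: le_Rintegral => //; first exact: measurableD.
- by apply: integrableS If => //; exact: measurableD.
- by apply: integrableS Ig => //; exact: measurableD.
- by move=> p [_]; exact: fg.
Qed.

Variable s : T -> R.
Hypothesis ms : measurable_fun setT s.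
Hypothesis s_ge0 : forall p, 0 <= s p.
Hypothesis s_le1 : forall p, s p <= 1.
Hypothesis s_null : mu [set p | s p = 0] = 0%E.

Let mN : measurable [set p | s p = 0].
Proof. exact: measurable_level. Qed.

Lemma bose_gapE s' t : bose_gap s t = wint mu s s' t 0.
Proof. by apply: eq_Rintegral => p _; rewrite mul0r addr0. Qed.

Lemma measurable_bose_int w t : measurable_fun setT w ->
  measurable_fun setT (fun p => w p * bose (t * s p)).
Proof.
move=> mw; apply: measurable_funM => //.
by apply: measurableT_comp; [exact: measurable_bose|exact: measurable_funM].
Qed.

Let Ig t : 0 < t -> mu.-integrable setT (EFin \o (fun p => s p * bose (t * s p))).
Proof.
move=> t0; apply: (bounded_integrable muT_lty (c := t^-1)).
  exact: measurable_bose_int.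
move=> p; have := @wbose_bound _ _ _ s s s_ge0 s_ge0 t 0 p t0 (lexx 0).
by rewrite mul0r addr0.
Qed.

Lemma bose_gap_le t : 0 < t -> t * bose_gap s t <= V.
Proof.
move=> t0; rewrite (bose_gapE s) -ler_pdivlMl//.
exact: (@wint_le_inv _ _ _ _ muT_lty s s ms ms s_ge0 s_ge0 t 0).
Qed.

(** The integrand [t s bose (t s)] is at least [e^-(t s)], hence at least [e^-t], except on the null
    set [s = 0], where it is 0. *)
Lemma bose_gap_ge t : 0 < t -> expR (- t) * V <= t * bose_gap s t.
Proof.
move=> t0; rewrite -Rintegral_cst// -RintegralZl//; last exact: Ig.
apply: (le_Rintegral_off mN s_null); first exact: integrable_cstr.
  by have := integrableZl measurableT t (Ig t0).
move=> p /eqP sn0; have sp : 0 < s p by rewrite lt_neqAle eq_sym sn0 s_ge0.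
have ts : 0 < t * s p by rewrite mulr_gt0.
rewrite mulrA (le_trans _ (expRN_le_mul_bose ts))// ler_expR lerN2.
by rewrite ler_piMr// ltW.
Qed.

Lemma bose_gap_gt0 t : 0 < t -> 0 < bose_gap s t.
Proof.
move=> t0; rewrite -(pmulr_rgt0 _ t0) (lt_le_trans _ (bose_gap_ge t0))//.
by rewrite mulr_gt0// expR_gt0.
Qed.

Lemma bose_gap_lt t t' : 0 < t -> t < t' -> bose_gap s t' < bose_gap s t.
Proof. by move=> t0 tt'; rewrite !(bose_gapE s); exact: lt_wint. Qed.

Lemma bose_gap_leP t t' : 0 < t -> 0 < t' -> bose_gap s t <= bose_gap s t' -> t' <= t.
Proof.
move=> t0 t'0; rewrite !leNgt; apply: contra; exact: bose_gap_lt.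
Qed.

(* A function squeezed between [e ^ -t C / t] and [C / t] takes values above
   any [m] on [(0, 1]]. *)
Lemma small_parameter (C m : R) : 0 < C -> 0 < m ->
  exists t, [/\ 0 < t, t <= C / m & forall F, expR (- t) * C <= t * F -> m <= F].
Proof.
move=> C0 m0; have e0 : 0 < expR (-1) :> R by exact: expR_gt0.
have e1 : expR (-1) <= 1 :> R by rewrite expR_le1 oppr_le0.
(* For [t <= 1] one has [e^-1 <= e^-t], so [t <= e^-1 C / m] gives [t m <= e^-t C <= t F]. *)
exists (Num.min 1 (expR (-1) * C / m)); split.
- by rewrite lt_min ltr01 divr_gt0// mulr_gt0.
- by rewrite ge_min ler_pM2r ?invr_gt0// ger_pMl// e1 orbT.
set t := Num.min _ _ => F tF.
have t0 : 0 < t by rewrite lt_min ltr01 divr_gt0// mulr_gt0.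
have t1 : t <= 1 by rewrite ge_min lexx.
have tC : t * m <= expR (-1) * C by rewrite -ler_pdivlMr// ge_min lexx orbT.
rewrite -(ler_pM2l t0) (le_trans tC)// (le_trans _ tF)// ler_pM2r// ler_expR.
by rewrite lerN2.
Qed.

Lemma bose_gap_surj p0 : 0 < p0 -> exists2 t, 0 < t & bose_gap s t = p0.
Proof.
move=> p00; have [t [t0 _ /(_ (bose_gap s t) (bose_gap_ge t0))]] :=
  small_parameter V_gt0 p00.
rewrite (bose_gapE s) => pW.
have [t' tt' Pt'] := wint_solve muT_gt0 muT_lty ms ms s_ge0 s_ge0 t0 (lexx 0) p00 pW.
by exists t'; [exact: lt_le_trans tt'|rewrite (bose_gapE s)].
Qed.

Lemma gap0 : gap s 0 = 0.
Proof. by rewrite /gap ltxx. Qed.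

Section infinite.
Hypothesis Nint : ~ mu.-integrable setT (EFin \o (fun p => (s p)^-1)).

Lemma gap_infinite m : gap s m = 0.
Proof. by rewrite /gap; case: asboolP; rewrite ?andbF. Qed.

(** [1 / s] is bounded by [e^t t bose (t s)], so a finite mass would make [1 / s] integrable. *)
Lemma bose_mass_infinite t : 0 < t ->
  (\int[mu]_p (bose (t * s p))%:E = +oo)%E.
Proof.
move=> t0; apply: contra_notP Nint => /eqP; rewrite -ltey => Iy.
have mb : measurable_fun setT (fun p => bose (t * s p)).
  by apply: measurableT_comp; [exact: measurable_bose|exact: measurable_funM].
have b0 p : 0 <= bose (t * s p) by rewrite bose_ge0// mulr_ge0// ltW.
have Ib : mu.-integrable setT (EFin \o (fun p => bose (t * s p))).
  exact: ge0_integrable_fin.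
have := integrableZl measurableT (expR t * t) Ib.
apply: le_integrable => //.
  apply/measurable_EFinP; exact: (measurableT_comp (@measurable_invr R)).
move=> p _ /=; rewrite lee_fin ger0_norm ?invr_ge0// ger0_norm; last first.
  by rewrite !mulr_ge0 ?expR_ge0// ltW.
have := s_ge0 p; rewrite le_eqVlt => /predU1P[<-|sp].
  by rewrite invr0 mulr0 bose0 mulr0.
have ts : 0 < t * s p by rewrite mulr_gt0.
rewrite -[leLHS]mul1r ler_pdivrMr//.
have -> : expR t * t * bose (t * s p) * s p = expR t * (t * s p * bose (t * s p)) by ring.
rewrite -ler_pdivrMl ?expR_gt0// mulr1 -expRN.
by rewrite (le_trans _ (expRN_le_mul_bose ts))// ler_expR lerN2 ler_piMr// ltW.
Qed.

End infinite.

Section finite.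
Hypothesis Iinv : mu.-integrable setT (EFin \o (fun p => (s p)^-1)).

Local Notation I := (\int[mu]_p (s p)^-1).

Lemma weight_bose_bound w t p : 0 < t -> 0 <= w p <= 1 ->
  0 <= w p * bose (t * s p) <= t^-1 * (s p)^-1.
Proof.
move=> t0 /andP[w0 w1]; have ts : 0 <= t * s p by rewrite mulr_ge0// ltW.
rewrite mulr_ge0 ?bose_ge0//= (le_trans _ (_ : bose (t * s p) <= _))//.
  by rewrite ler_piMl// bose_ge0.
by rewrite (le_trans (bose_le_inv ts))// invfM.
Qed.

Lemma integrable_weight_bose w t : measurable_fun setT w ->
  (forall p, 0 <= w p <= 1) -> 0 < t ->
  mu.-integrable setT (EFin \o (fun p => w p * bose (t * s p))).
Proof.
move=> mw w01 t0; have := integrableZl measurableT t^-1 Iinv.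
apply: le_integrable => //.
  by apply/measurable_EFinP; exact: measurable_bose_int.
move=> p _ /=; have /andP[h1 h2] := weight_bose_bound t0 (w01 p).
by rewrite lee_fin !ger0_norm// (le_trans h1 h2).
Qed.

(** The weight [w] is 1 for the mass and [s] for the gap. Differentiation under the integral sign
    takes place on [(t / 2, t + 1)], away from the singularity at parameter 0. *)
Lemma is_derive_bose_int w t : measurable_fun setT w ->
  (forall p, 0 <= w p <= 1) -> 0 < t ->
  is_derive t 1 (bose_int w s)
    (- \int[mu]_p (w p * s p * (bose (t * s p) * (1 + bose (t * s p))))).
Proof.
move=> mw w01 t0; have t20 : 0 < t / 2 by rewrite divr_gt0.
pose f t p := w p * bose (t * s p).
have df (x : R) (p : T) : 0 < x ->
    is_derive x 1 (f ^~ p) (- (w p * s p * (bose (x * s p) * (1 + bose (x * s p))))).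
  move=> x0; have := s_ge0 p; rewrite le_eqVlt => /predU1P[s0|sp].
    rewrite (_ : f ^~ p = cst 0); last first.
      by apply/funext => y; rewrite /f -s0 mulr0 bose0 mulr0.
    by rewrite -s0 mulr0 mul0r oppr0; exact: is_derive_cst.
  have xs0 : 0 < x * s p by rewrite mulr_gt0.
  have db := is_derive_bose xs0.
  have dm : is_derive x 1 (fun y => y * s p) (s p).
    have := @is_deriveM _ _ id (cst (s p)) x 1 _ _ (is_derive_id _ _) (is_derive_cst _ _ _).
    by rewrite scaler0 add0r /GRing.scale/= mulr1.
  have dc := @is_derive1_comp _ (@bose R) (fun y => y * s p) x _ _ db dm.
  have := @is_deriveM _ _ (cst (w p)) _ x 1 _ _ (is_derive_cst _ _ _) dc.
  rewrite scaler0 addr0 /GRing.scale/=.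
  move=> H; rewrite (_ : - _ = w p * (- (bose (x * s p) * (1 + bose (x * s p))) * s p)) //.
  ring.
pose k := (t / 2)^-1.
have k0 : 0 < k by rewrite invr_gt0.
have inI (x : R) : `]t / 2, t + 1[%classic x -> t / 2 < x.
  by rewrite /= in_itv/= => /andP[].
have tI : `]t / 2, t + 1[%classic t.
  by rewrite /= in_itv/= ltrDl ltr01 ltr_pdivrMr// mulr_natr mulr2n ltrDl t0.
have If (x : R) : `]t / 2, t + 1[%classic x -> mu.-integrable setT (EFin \o f x).
  by move=> /inI tx; apply: integrable_weight_bose => //; exact: lt_trans tx.
(* The derivative is [w s b (1 + b)] up to sign, with [b = bose (x s)]. Here [s b <= 1 / x <= k] and
   [b <= 1 / (x s) <= k / s]; only the single factor [1 / s] survives, and it is integrable. *)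
pose G p := k * (1 + k * (s p)^-1).
have G0 p : 0 <= G p.
  by rewrite mulr_ge0 ?(ltW k0)// addr_ge0// mulr_ge0 ?(ltW k0)// invr_ge0.
have IG : mu.-integrable setT (EFin \o G).
  by have := integrableZl measurableT k (integrableD measurableT
    (integrable_cstr 1) (integrableZl measurableT k Iinv)).
have fG (x : R) (p : T) : `]t / 2, t + 1[%classic x -> setT p -> `|partial1of2 f x p| <= G p.
  move=> /inI tx _; have x0 : 0 < x by exact: lt_trans tx.
  have xk : x^-1 <= k by rewrite lef_pV2 ?posrE// ltW.
  have := df x p x0 => dfx; rewrite partial1of2E derive_val normrN.
  have /andP[w0 w1] := w01 p.
  have xs0 : 0 <= x * s p by rewrite mulr_ge0// ltW.
  have b0 := bose_ge0 xs0.
  have /andP[sb0 sbk] := @wbose_bound _ _ _ s s s_ge0 s_ge0 x 0 p x0 (lexx 0).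
  move: sb0 sbk; rewrite mul0r addr0 => sb0 sbk.
  have b10 : 0 <= 1 + bose (x * s p) by rewrite addr_ge0.
  rewrite ger0_norm; last by rewrite !mulr_ge0.
  rewrite -mulrA [s p * _]mulrA.
  apply: (le_trans (_ : _ <= s p * bose (x * s p) * (1 + bose (x * s p)))).
    by rewrite ler_piMl// mulr_ge0.
  apply: ler_pM => //; first exact: le_trans xk.
  rewrite lerD2l (le_trans (bose_le_inv xs0))// invfM ler_wpM2r// invr_ge0.
  exact: s_ge0.
have dft (x : R) (p : T) : `]t / 2, t + 1[%classic x -> setT p -> derivable (f ^~ p) x 1.
  by move=> /inI tx _; have [] := df x p (lt_trans t20 tx).
apply: DeriveDef.
  exact: (@derivable_under_integral _ _ _ mu f setT measurableT _ _ _ tI If dft _ G0 IG fG).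
rewrite -derive1E.
rewrite (@differentiation_under_integral _ _ _ mu f setT measurableT _ _ _ tI If dft _ G0 IG fG).
have IW : mu.-integrable setT
    (EFin \o (fun p => w p * s p * (bose (t * s p) * (1 + bose (t * s p))))).
  apply: le_integrable IG => //.
    apply/measurable_EFinP; apply: measurable_funM; first exact: measurable_funM.
    have mb : measurable_fun setT (fun p => bose (t * s p)).
      by apply: measurableT_comp; [exact: measurable_bose|exact: measurable_funM].
    by apply: measurable_funM => //; exact: measurable_funD.
  move=> p _ /=; rewrite lee_fin [leRHS]ger0_norm//.
  have dft' := df t p t0.
  by have := fG t p tI Logic.I; rewrite partial1of2E derive_val normrN.
rewrite -[RHS]mulN1r -RintegralZl//; apply: eq_Rintegral => p _.
have dft' := df t p t0.
by rewrite partial1of2E derive_val mulN1r.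
Qed.

End finite.

End gap.

(** * The gap as a function of the mass when [1 / s] is integrable *)

Section finite_gap.
Context d (T : measurableType d) (R : realType).
Variable mu : {measure set T -> \bar R}.
Hypothesis muT_gt0 : (0 < mu setT)%E.
Hypothesis muT_lty : (mu setT < +oo)%E.
Variable s : T -> R.
Hypothesis ms : measurable_fun setT s.
Hypothesis s_ge0 : forall p, 0 <= s p.
Hypothesis s_le1 : forall p, s p <= 1.
Hypothesis s_null : mu [set p | s p = 0] = 0%E.
Hypothesis Iinv : mu.-integrable setT (EFin \o (fun p => (s p)^-1)).
Implicit Types t m : R.

Local Notation V := (fine (mu setT)).
Local Notation I := (\int[mu]_p (s p)^-1).
Local Notation M := (bose_mass mu s).
Local Notation P := (bose_gap mu s).
Local Notation tau := (mass_inv mu s).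
Local Notation g := (gap mu s).

Let mN : measurable [set p | s p = 0].
Proof. exact: measurable_level. Qed.

Let s_gt0 p : ~ [set p | s p = 0] p -> 0 < s p.
Proof. by move=> /eqP sn0; rewrite lt_neqAle eq_sym sn0 s_ge0. Qed.

Let IM t : 0 < t -> mu.-integrable setT (EFin \o (fun p => cst 1 p * bose (t * s p))).
Proof. by move=> t0; apply: integrable_weight_bose => // p; rewrite /= ler01 lexx. Qed.

Let IP t : 0 < t -> mu.-integrable setT (EFin \o (fun p => s p * bose (t * s p))).
Proof. by move=> t0; apply: integrable_weight_bose => // p; rewrite s_ge0 s_le1. Qed.

Let V_gt0 : 0 < V.
Proof. by apply: fine_gt0; rewrite muT_gt0 muT_lty. Qed.

Lemma Rintegral_inv_gt0 : 0 < I.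
Proof.
have := @lt_Rintegral _ _ _ mu muT_gt0 _ (cst 0) (fun p => (s p)^-1) s_null _ Iinv mN.
rewrite Rintegral_cst// mul0r; apply; first exact: integrable_cstr.
  by move=> p; rewrite invr_ge0.
by move=> p /s_gt0; rewrite invr_gt0.
Qed.

Let I_gt0 : 0 < I.
Proof. exact: Rintegral_inv_gt0. Qed.

Lemma bose_mass_le t : 0 < t -> M t <= I / t.
Proof.
move=> t0; rewrite mulrC -RintegralZl//; apply: le_Rintegral => //.
- exact: IM.
- by have := integrableZl measurableT t^-1 Iinv.
- move=> p _; have w01 : 0 <= cst (1 : R) p <= 1 by rewrite ler01 lexx.
  by have /andP[] := weight_bose_bound s_ge0 t0 w01.
Qed.

Lemma bose_mass_ge t : 0 < t -> expR (- t) * I <= t * M t.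
Proof.
move=> t0; rewrite -!RintegralZl//; last exact: IM.
apply: (le_Rintegral_off mN s_null).
- by have := integrableZl measurableT (expR (- t)) Iinv.
- by have := integrableZl measurableT t (IM t0).
move=> p /s_gt0 sp; have ts : 0 < t * s p by rewrite mulr_gt0.
rewrite ler_pdivrMr//= mul1r mulrAC (le_trans _ (expRN_le_mul_bose ts))//.
by rewrite ler_expR lerN2 ler_piMr// ltW.
Qed.

Lemma bose_mass_gt0 t : 0 < t -> 0 < M t.
Proof.
move=> t0; rewrite -(pmulr_rgt0 _ t0) (lt_le_trans _ (bose_mass_ge t0))//.
by rewrite mulr_gt0// expR_gt0.
Qed.

Lemma bose_mass_lt t t' : 0 < t -> t < t' -> M t' < M t.
Proof.
move=> t0 tt'; have t'0 : 0 < t' by exact: lt_trans tt'.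
apply: (@lt_Rintegral _ _ _ mu muT_gt0 _ _ _ s_null) => //.
- exact: IM.
- exact: IM.
- move=> p; have := s_ge0 p; rewrite le_eqVlt => /predU1P[<-|sp].
    by rewrite !mulr0.
  by rewrite !mul1r bose_le ?mulr_gt0// ler_pM2r// ltW.
- by move=> p /s_gt0 sp; rewrite !mul1r bose_lt ?mulr_gt0// ltr_pM2r.
Qed.

Lemma bose_mass_leP t t' : 0 < t -> 0 < t' -> M t <= M t' -> t' <= t.
Proof. by move=> t0 t'0; rewrite !leNgt; apply: contra; exact: bose_mass_lt. Qed.

Lemma bose_mass_inj t t' : 0 < t -> 0 < t' -> M t = M t' -> t = t'.
Proof.
move=> t0 t'0 E; have h1 : M t <= M t' by rewrite E.
have h2 : M t' <= M t by rewrite E.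
by apply/le_anti; rewrite (bose_mass_leP t'0 t0 h2) (bose_mass_leP t0 t'0 h1).
Qed.

Let is_derive_M t : 0 < t -> is_derive t 1 M
  (- \int[mu]_p (cst 1 p * s p * (bose (t * s p) * (1 + bose (t * s p))))).
Proof.
by move=> t0; apply: is_derive_bose_int => // p; rewrite /= ler01 lexx.
Qed.

Lemma continuous_bose_mass t : 0 < t -> {for t, continuous M}.
Proof.
move=> t0; apply/differentiable_continuous/derivable1_diffP.
by have [] := is_derive_M t0.
Qed.

Lemma derivable_bose_gap t : 0 < t -> derivable P t 1.
Proof.
move=> t0.
have [] // := is_derive_bose_int muT_lty ms s_ge0 Iinv ms _ t0.
by move=> p; rewrite s_ge0 s_le1.
Qed.

Lemma bose_mass_surj m : 0 < m -> exists2 t, 0 < t & M t = m.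
Proof.
move=> m0; have [t [t0 tI /(_ (M t) (bose_mass_ge t0)) mM]] :=
  small_parameter Rintegral_inv_gt0 m0.
(* [I / m] is the parameter at which the upper bound [I / t] of the mass equals [m]. *)
have Mm : M (I / m) <= m.
  apply: le_trans (bose_mass_le _) _; first exact: divr_gt0.
  by rewrite invf_div mulrCA divff ?gt_eqF// mulr1.
have [|t' /andP[tt' _] Mt'] := @IVT_nonincreasing _ M _ _ _ tI _ Mm mM.
  apply: continuous_in_subspaceT => z /set_mem/=; rewrite in_itv/= => /andP[tz _].
  by apply: continuous_bose_mass; exact: lt_le_trans tz.
by exists t' => //; exact: lt_le_trans tt'.
Qed.

Let tauP m : 0 < m -> 0 < tau m /\ M (tau m) = m.
Proof.
by move=> /bose_mass_surj[t t0 Mt]; apply: (@xgetPex _ 0 [set t | 0 < t /\ M t = m]); exists t.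
Qed.

Let tauK t : 0 < t -> tau (M t) = t.
Proof.
by move=> t0; have [t'0 /bose_mass_inj->] := tauP (bose_mass_gt0 t0).
Qed.

Let gE m : 0 < m -> g m = P (tau m).
Proof. by move=> m0; rewrite /gap m0 asboolT. Qed.

Lemma gapE t : 0 < t -> g (M t) = P t.
Proof. by move=> t0; rewrite (gE (bose_mass_gt0 t0)) (tauK t0). Qed.

(** The gap is [P \o tau] with [tau] the inverse of [M]. The inverse function theorem applies
    because [M'] is minus the integral of a function that is positive almost everywhere. *)
Lemma derivable_gap m : 0 < m -> derivable g m 1.
Proof.
move=> m0; have [t0 Mt] := tauP m0; set t := tau m in t0 Mt.
pose l := - \int[mu]_p (cst 1 p * s p * (bose (t * s p) * (1 + bose (t * s p)))).
have npos (x : R) : 0 < x -> \forall z \near x, 0 < z.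
  by move=> x0; exact: lt_nbhsr.
have l0 : l != 0.
  rewrite oppr_eq0 gt_eqF//.
  have b0 p : 0 <= bose (t * s p) by rewrite bose_ge0// mulr_ge0// ltW.
  have := @lt_Rintegral _ _ _ mu muT_gt0 _ (cst 0)
    (fun p => cst 1 p * s p * (bose (t * s p) * (1 + bose (t * s p)))) s_null.
  rewrite Rintegral_cst// mul0r; apply => //.
  - exact: integrable_cstr.
  - have mb : measurable_fun setT (fun p => bose (t * s p)).
      by apply: measurableT_comp; [exact: measurable_bose|exact: measurable_funM].
    apply: (le_integrable measurableT _ _ (integrableD measurableT
      (integrable_cstr muT_lty t^-1)
      (integrableZl measurableT (t^-1 * t^-1) Iinv))).
      apply/measurable_EFinP; apply: measurable_funM; first exact: measurable_funM.
      by apply: measurable_funM => //; exact: measurable_funD.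
    move=> p _ /=; rewrite lee_fin ger0_norm; last first.
      by rewrite !mulr_ge0// addr_ge0.
    rewrite mul1r; apply: le_trans (ler_norm _).
    have := @wbose_bound _ _ _ s s s_ge0 s_ge0 t 0 p t0 (lexx 0).
    rewrite mul0r addr0 => /andP[h0 h1].
    rewrite mulrA (le_trans (_ : _ <= t^-1 * (1 + t^-1 * (s p)^-1)))//; last first.
      by rewrite mulrDr mulr1 mulrA.
    rewrite ler_pM// ?addr_ge0// lerD2l -invfM bose_le_inv// mulr_ge0//.
    exact: ltW.
  - by move=> p; rewrite !mulr_ge0// addr_ge0.
  - move=> p /s_gt0 sp; have bp : 0 < bose (t * s p) by rewrite bose_gt0// mulr_gt0.
    by rewrite !mulr_gt0// addr_gt0.
have dtau : is_derive m 1 tau l^-1.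
  rewrite -{1}Mt; apply: is_derive_inverse => //.
  - by near=> z; apply: tauK; near: z; exact: npos.
  - by near=> z; apply: continuous_bose_mass; near: z; exact: npos.
  - exact: is_derive_M.
have dP : derivable P (tau m) 1 by exact: derivable_bose_gap.
have dg : derivable (P \o tau) m 1.
  apply/derivable1_diffP; apply: differentiable_comp; apply/derivable1_diffP.
    by have [] := dtau.
  exact: dP.
apply: near_eq_derivable dg => //.
by near=> z; rewrite /= gE//; near: z; exact: npos.
Unshelve. all: end_near. Qed.

Lemma gap_lt x y : 0 <= x -> x < y -> g x < g y.
Proof.
rewrite le_eqVlt => /predU1P[<- y0|x0 xy].
  by rewrite gap0 gE// bose_gap_gt0//; have [] := tauP y0.
have y0 : 0 < y by exact: lt_trans xy.
have [tx Mx] := tauP x0; have [ty My] := tauP y0.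
rewrite !gE// bose_gap_lt// ltNge; apply/negP => txy.
suff : y <= x by rewrite leNgt xy.
have [E|] := eqVneq (tau x) (tau y); first by rewrite -Mx -My E.
move=> E; have {E txy} : tau x < tau y by rewrite lt_neqAle E.
by move=> /(bose_mass_lt tx)/ltW; rewrite Mx My.
Qed.

(** At parameter [t], mass minus gap is [\int (1 - s) bose (t s)], and a larger mass means a smaller
    [t]. Strictness needs the weight [1 - s] to vanish only on a null set. With [s = 1 - omega] this
    is the monotonicity of [f_+]. *)
Lemma sub_gap_lt x y : mu [set p | s p = 1] = 0%E -> 0 <= x -> x < y ->
  x - g x < y - g y.
Proof.
move=> s1.
have ME t : 0 < t -> M t - P t = \int[mu]_p (cst 1 p * bose (t * s p) - s p * bose (t * s p)).
  by move=> t0; rewrite RintegralB//; [exact: IM|exact: IP].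
have I1 t : 0 < t -> mu.-integrable setT
    (EFin \o (fun p => cst 1 p * bose (t * s p) - s p * bose (t * s p))).
  move=> t0; have := integrableB measurableT (IM t0) (IP t0).
  by apply: eq_integrable => // p _.
have mN1 : measurable ([set p | s p = 0] `|` [set p | s p = 1]).
  by apply: measurableU => //; exact: measurable_level.
have N1 : mu ([set p | s p = 0] `|` [set p | s p = 1]) = 0%E.
  by apply: measureU_null => //; exact: measurable_level.
have b_ge0 t p : 0 < t -> 0 <= bose (t * s p).
  by move=> t0; rewrite bose_ge0// mulr_ge0// ltW.
have off p : ~ ([set p | s p = 0] `|` [set p | s p = 1]) p -> 0 < s p /\ 0 < 1 - s p.
  move=> /not_orP[/s_gt0 sp /= /eqP sn1]; split => //.
  by rewrite subr_gt0 lt_neqAle sn1 s_le1.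
rewrite le_eqVlt => /predU1P[<- y0|x0 xy].
  have [t0 {1}<-] := tauP y0; rewrite gap0 subrr gE// ME//.
  have := @lt_Rintegral _ _ _ mu muT_gt0 _ (cst 0) _ N1 _ (I1 _ t0) mN1.
  rewrite Rintegral_cst// mul0r; apply; first exact: integrable_cstr.
    by move=> p; rewrite -mulrBl mulr_ge0 ?subr_ge0// b_ge0.
  by move=> p /off[sp s1p]; rewrite -mulrBl mulr_gt0// bose_gt0// mulr_gt0.
have y0 : 0 < y by exact: lt_trans xy.
have [tx Mx] := tauP x0; have [ty My] := tauP y0.
rewrite (gE x0) (gE y0) -{1}Mx -{1}My (ME _ tx) (ME _ ty).
have tyx : tau y < tau x.
  rewrite ltNge; apply/negP; rewrite le_eqVlt => /predU1P[E|/(bose_mass_lt tx)].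
    by move: xy; rewrite -Mx -My E ltxx.
  by rewrite Mx My ltNge (ltW xy).
apply: (@lt_Rintegral _ _ _ mu muT_gt0 _ _ _ N1) => //.
- exact: I1.
- exact: I1.
- move=> p; rewrite -!mulrBl ler_wpM2l ?subr_ge0//.
  have := s_ge0 p; rewrite le_eqVlt => /predU1P[<-|sp].
    by rewrite !mulr0.
  by rewrite bose_le ?mulr_gt0// ler_pM2r// ltW.
- move=> p /off[sp s1p]; rewrite -!mulrBl ltr_pM2l//.
  by rewrite bose_lt ?mulr_gt0// ltr_pM2r.
Qed.

(** Choose [t] by the gap rather than by the mass. Since [P t = p0 <= P (tau m)] and [P] decreases,
    [tau m <= t], so the mass falls short of [m]; the shortfall can be placed where [s = 0], at no
    cost in gap. *)
Lemma gap_condensation p0 m : 0 < m -> 0 < p0 -> p0 <= g m ->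
  exists t, [/\ 0 < t, P t = p0 & M t <= m].
Proof.
move=> m0 p00 pg; have [t t0 Pt] := bose_gap_surj muT_gt0 muT_lty ms s_ge0 s_le1 s_null p00.
exists t; split => //; have [tm Mm] := tauP m0.
move: pg; rewrite gE// -Pt -{2}Mm => /(bose_gap_leP muT_gt0 muT_lty ms s_ge0 s_null t0 tm).
by rewrite le_eqVlt => /predU1P[->//|/(bose_mass_lt tm)/ltW].
Qed.

Lemma gap_interior_finite p0 m t : 0 < m -> 0 < t -> P t = p0 -> g m < p0 ->
  m < M t.
Proof.
move=> m0 t0 <-; have [tm Mm] := tauP m0; rewrite gE// => Pm.
rewrite -{1}Mm bose_mass_lt// ltNge; apply/negP.
rewrite le_eqVlt => /predU1P[E|].
  by move: Pm; rewrite E ltxx.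
by move=> /(bose_gap_lt muT_gt0 muT_lty ms s_ge0 s_null tm)/ltW; rewrite leNgt Pm.
Qed.

(** Large [m] means small [t], where [t P] and [t M] tend to [V] and [I]. The bound [t <= I / m]
    turns the error factors [e^-t] and [e^t] into functions of [m]. *)
Lemma gap_slope : g m / m @[m --> +oo] --> V / I.
Proof.
have lim k : k * (I / m) @[m --> +oo] --> k * (I * 0).
  apply: cvgM; first exact: cvg_cst.
  apply: cvgM; first exact: cvg_cst.
  apply/gtr0_cvgV0; last by [].
  by near=> z; near: z; exact: nbhs_pinfty_gt.
have lime k : expR (k * (I / m)) * (V / I) @[m --> +oo] --> V / I.
  rewrite -[X in _ --> X]mul1r -expR0; apply: cvgM; last exact: cvg_cst.
  apply: continuous_cvg; first exact: continuous_expR.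
  by have := lim k; rewrite !mulr0.
apply: (squeeze_cvgr _ (lime (-1)) (lime 1)).
near=> m; have m0 : 0 < m by near: m; exact: nbhs_pinfty_gt.
have [t0 Mt] := tauP m0; rewrite gE// mulN1r mul1r; set t := tau m in t0 Mt *.
have tI : t <= I / m.
  by rewrite ler_pdivlMr// -Mt -ler_pdivlMl// mulrC bose_mass_le.
have tV := bose_gap_le muT_lty ms s_ge0 t0.
have Vt := bose_gap_ge muT_lty ms s_ge0 s_le1 s_null t0.
have Ml : t * m <= I by rewrite -ler_pdivlMr// mulrC -ler_pdivlMl// mulrC.
have Mg := bose_mass_ge t0; rewrite Mt in Mg.
have tm0 : 0 < t * m by rewrite mulr_gt0.
apply/andP; split.
  rewrite ler_pdivlMr// (le_trans (_ : _ <= expR (- t) * (V / I) * m))//.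
    rewrite ler_pM2r// ler_pM2r ?divr_gt0// ler_expR lerN2.
    exact: tI.
  rewrite -(ler_pM2l t0) (le_trans _ Vt)//.
  have -> : t * (expR (- t) * (V / I) * m) = expR (- t) * V * ((t * m) / I) by ring.
  apply: ler_piMr; last by rewrite ler_pdivrMr// mul1r.
  by rewrite mulr_ge0 ?expR_ge0// ltW.
rewrite ler_pdivrMr// (le_trans (_ : _ <= expR t * (V / I) * m))//; last first.
  by rewrite ler_pM2r// ler_pM2r ?divr_gt0// ler_expR.
rewrite -(ler_pM2l t0) (le_trans tV)//.
have -> : t * (expR t * (V / I) * m) = V * (expR t * ((t * m) / I)) by ring.
apply: ler_peMr; first exact: ltW.
rewrite -ler_pdivrMl ?expR_gt0// mulr1 -expRN.
by rewrite ler_pdivlMr.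
Unshelve. all: end_near. Qed.

Hypothesis s_full : forall e, 0 < e -> (0 < mu [set p | (s p < e)%R])%E.

(** Split at [s = h = e / 2]. The part below [h] contributes at most [h M], the rest at most
    [V bose (t h)]. The latter is negligible because the mass is at least [k bose (t h / 2)], coming
    from the set [s < h / 2] of positive measure [k]. *)
Lemma bose_gap_small e : 0 < e -> exists2 t0, 0 < t0 &
  forall t, t0 <= t -> P t <= e * M t.
Proof.
move=> e0; pose h := e / 2; have h0 : 0 < h by rewrite divr_gt0.
have hh0 : 0 < h / 2 by rewrite divr_gt0.
pose A := [set p | s p < h / 2]; pose k := fine (mu A).
have mA : measurable A by exact: measurable_sublevel.
have muA : (mu A < +oo)%E.
  by rewrite (le_lt_trans _ muT_lty)// le_measure ?inE.
have k0 : 0 < k by apply: fine_gt0; rewrite muA s_full.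
(* By [bose_double] at [t h / 2], [h M] is at least [(t h h k / 2) bose (t h)]; this threshold makes
   the coefficient at least [V]. *)
exists (2 * V / (h * h * k)); first by rewrite divr_gt0// ?mulr_gt0.
move=> t; rewrite ler_pdivrMr ?mulr_gt0// => tV.
have t0 : 0 < t.
  have : 0 < t * (h * h * k) by rewrite (lt_le_trans _ tV)// mulr_gt0.
  by rewrite pmulr_lgt0// ?mulr_gt0.
have th0 : 0 < t * h by rewrite mulr_gt0.
have PM : P t <= h * M t + V * bose (t * h).
  rewrite [V * _]mulrC -Rintegral_cst// -RintegralZl//; last exact: IM.
  have IZ := integrableZl measurableT h (IM t0).
  rewrite -RintegralD//; last exact: integrable_cstr.
  apply: le_Rintegral => //.
  - exact: IP.
  - have := integrableD measurableT IZ (integrable_cstr muT_lty (bose (t * h))).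
    by apply: eq_integrable => // p _.
  move=> p _; have b0 q : 0 <= q -> 0 <= bose (t * q).
    by move=> q0; rewrite bose_ge0// mulr_ge0// ltW.
  rewrite mul1r; have [sh|hs] := ltP (s p) h.
    apply: (@le_trans _ _ (h * bose (t * s p))); last by rewrite lerDl b0// ltW.
    by rewrite ler_wpM2r ?b0// ltW.
  apply: (@le_trans _ _ (bose (t * h))).
    apply: (@le_trans _ _ (bose (t * s p))); first by rewrite ler_piMl ?b0.
    by rewrite bose_le// ler_pM2l.
  by rewrite lerDr mulr_ge0 ?b0// ltW.
have IA : mu.-integrable setT (EFin \o (\1_A : T -> R)).
  by apply: (bounded_integrable muT_lty (c := 1)) => // p; rewrite indicE ler0n lern1 leq_b1.
have kM : k * bose (t * (h / 2)) <= M t.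
  have -> : k * bose (t * (h / 2)) = \int[mu]_p (bose (t * (h / 2)) * \1_A p).
    rewrite RintegralZl//.
    by rewrite mulrC /Rintegral integral_indic// setIT.
  apply: (le_Rintegral_off mN s_null).
  - have := integrableZl measurableT (bose (t * (h / 2))) IA.
    by apply: eq_integrable => // p _.
  - exact: IM.
  move=> p /s_gt0 sp; rewrite mul1r indicE.
  have [pA|pA] := boolP (p \in A); last by rewrite mulr0 bose_ge0// mulr_ge0// ltW.
  rewrite mulr1 bose_le ?mulr_gt0// ler_pM2l// ltW//.
  by move: pA; rewrite inE.
have th2 : 0 < t * (h / 2) by rewrite mulr_gt0.
have := bose_double th2.
have -> : 2 * (t * (h / 2)) = t * h by field.
move=> bd.
rewrite (le_trans PM)// (splitr e) mulrDl lerD2l -/h.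
have {bd}bd : k * (t * (h / 2) * bose (t * h)) <= M t.
  by rewrite (le_trans _ kM)// ler_pM2l.
rewrite (le_trans _ (ler_wpM2l (ltW h0) bd))//.
have -> : h * (k * (t * (h / 2) * bose (t * h))) = (t * (h * h * k)) / 2 * bose (t * h) by field.
apply: ler_wpM2r; first by rewrite bose_ge0// ltW.
by rewrite ler_pdivlMr// mulrC.
Qed.

(** Small masses correspond to large parameters. Consequently the gap contributes nothing to the
    one-sided derivative of [f_+] and [f_-] at 0. *)
Lemma gap_cvg0 : g h / h @[h --> 0^'+] --> 0.
Proof.
apply/cvgrPdist_le => e e0.
have [t0 t00 Pt] := bose_gap_small e0.
near=> h.
have h0 : 0 < h by near: h; exact: nbhs_right_gt.
have hM : h < M t0 by near: h; apply: nbhs_right_lt; exact: bose_mass_gt0.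
have [th Mh] := tauP h0; have P0 : 0 < P (tau h) by exact: bose_gap_gt0.
rewrite (gE h0) sub0r normrN (ger0_norm (divr_ge0 (ltW P0) (ltW h0))).
rewrite ler_pdivrMr// -{2}Mh; apply: Pt.
by apply: (bose_mass_leP th t00); rewrite Mh (ltW hM).
Unshelve. all: end_near. Qed.

End finite_gap.

(** * Comparing the gap with the mean of [s], and the mass on an edge *)

Section gap_mean.
Context d (T : measurableType d) (R : realType).
Variable mu : {measure set T -> \bar R}.
Hypothesis muT_gt0 : (0 < mu setT)%E.
Hypothesis muT_lty : (mu setT < +oo)%E.
Variable s : T -> R.
Hypothesis ms : measurable_fun setT s.
Hypothesis s_ge0 : forall p, 0 <= s p.
Hypothesis s_le1 : forall p, s p <= 1.
Hypothesis s_null : mu [set p | s p = 0] = 0%E.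

Local Notation V := (fine (mu setT)).

Let V_gt0 : 0 < V.
Proof. by apply: fine_gt0; rewrite muT_gt0 muT_lty. Qed.

Let mN : measurable [set p | s p = 0].
Proof. exact: measurable_level. Qed.

Let s_gt0 p : ~ [set p | s p = 0] p -> 0 < s p.
Proof. by move=> /eqP sn0; rewrite lt_neqAle eq_sym sn0 s_ge0. Qed.

Let Is : mu.-integrable setT (EFin \o s).
Proof. by apply: (bounded_integrable muT_lty (c := 1)) => // p; rewrite s_ge0 s_le1. Qed.

(* Chebyshev's correlation inequality: [bose (t * s)] decreases with [s]. *)
Lemma gap_le_mean m : 0 <= m -> gap mu s m <= (\int[mu]_p s p) / V * m.
Proof.
set c := _ / V.
have c0 : 0 < c.
  rewrite divr_gt0//; have := @lt_Rintegral _ _ _ mu muT_gt0 _ (cst 0) s s_null _ Is mN.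
  by rewrite Rintegral_cst// mul0r; apply => //; exact: integrable_cstr.
rewrite le_eqVlt => /predU1P[<-|m0]; first by rewrite gap0 mulr0.
have [Iinv|/gap_infinite->] :=
    pselect (mu.-integrable setT (EFin \o (fun p => (s p)^-1))); last first.
  by rewrite mulr_ge0// ltW.
have [t t0 <-] := bose_mass_surj muT_gt0 muT_lty ms s_ge0 s_le1 s_null Iinv m0.
rewrite gapE// -subr_ge0.
have I1 : mu.-integrable setT (EFin \o (fun p => cst 1 p * bose (t * s p))).
  by apply: integrable_weight_bose => // p; rewrite /= ler01 lexx.
have I2 : mu.-integrable setT (EFin \o (fun p => s p * bose (t * s p))).
  by apply: integrable_weight_bose => // p; rewrite s_ge0 s_le1.
rewrite -RintegralZl// -RintegralB//; last exact: (integrableZl measurableT c I1).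
(* As [c] is the mean of [s], subtracting this zero integral replaces the integrand
   [(c - s) bose (t s)] by [(c - s) (bose (t s) - bose (t c))], whose factors have the same sign. *)
have E : \int[mu]_p (bose (t * c) * (c - s p)) = 0.
  have Ic := integrable_cstr muT_lty c.
  rewrite RintegralZl//; last first.
    by have := integrableB measurableT Ic Is; apply: eq_integrable.
  by rewrite RintegralB// Rintegral_cst// divfK ?gt_eqF// subrr mulr0.
rewrite -E; apply: (le_Rintegral_off mN s_null).
- have := integrableZl measurableT (bose (t * c))
    (integrableB measurableT (integrable_cstr muT_lty c) Is).
  by apply: eq_integrable.
- have := integrableB measurableT (integrableZl measurableT c I1) I2.
  by apply: eq_integrable.
move=> p /s_gt0 sp; rewrite mul1r -mulrBl mulrC -subr_ge0 -mulrBr.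
have tc : 0 < t * c by rewrite mulr_gt0.
have ts : 0 < t * s p by rewrite mulr_gt0.
have [cs|sc] := leP c (s p).
  by apply: mulr_le0; rewrite subr_le0// bose_le// ler_pM2l.
by apply: mulr_ge0; rewrite subr_ge0 ?(ltW sc)// bose_le// ler_pM2l// ltW.
Qed.

(** A gap above that of mass [m] means a parameter below [tau m], hence a larger mass. If [1 / s] is
    not integrable the mass is infinite; stating the conclusion in [\bar R] lets the interior
    argument ignore the distinction. *)
Lemma gap_interior m t : 0 < m -> 0 < t -> gap mu s m < bose_gap mu s t ->
  (m%:E < \int[mu]_p (bose (t * s p))%:E)%E.
Proof.
move=> m0 t0 gP.
have [Iinv|Iinv] := pselect (mu.-integrable setT (EFin \o (fun p => (s p)^-1))); last first.
  by rewrite (bose_mass_infinite ms s_ge0 s_le1 Iinv t0) ltry.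
have := gap_interior_finite muT_gt0 muT_lty ms s_ge0 s_le1 s_null Iinv m0 t0 erefl gP.
rewrite -lte_fin => /lt_le_trans; apply.
have I1 : mu.-integrable setT (EFin \o (fun p => cst 1 p * bose (t * s p))).
  by apply: integrable_weight_bose => // p; rewrite /= ler01 lexx.
rewrite fineK ?(integrable_fin_num measurableT I1)//.
by under eq_integral do rewrite mul1r.
Qed.

End gap_mean.

(** * Measures on the torus *)

Section torus_lebesgue_support.
Variables (R : realType) (d : nat).
Local Notation mR := (measurableTypeR R).

Definition box n (a b : 'I_n -> R) : set (n.-tuple mR) :=
  [set t | forall i, a i <= tnth t i :> R /\ tnth t i < b i :> R].

Lemma measurable_box n (a b : 'I_n -> R) : measurable (box a b).
Proof.
have -> : box a b = \bigcap_(i : 'I_n) ((@tnth n mR ^~ i) @^-1` `[a i, b i[).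
  apply/seteqP; split => t /= h i; first by move=> _; rewrite /= in_itv/=; apply/andP.
  by have := h i Logic.I; rewrite /= in_itv/= => /andP.
apply: fin_bigcap_measurable => [|i _]; first exact: finite_finset.
by rewrite -[X in measurable X]setTI; exact: measurable_tnth.
Qed.

Lemma lebesgue_box_gt0 n (a b : 'I_n -> R) : (forall i, a i < b i) ->
  (0 < lebesgue_tuple R n (box a b))%E.
Proof.
elim: n a b => [|n IH] a b ab.
  by rewrite /= /lebesgue_tuple0 diracE mem_set ?lte01// => -[].
pose a' i := a (lift ord0 i); pose b' i := b (lift ord0 i).
have -> : box a b = [set t | `[a ord0, b ord0[%classic (thead t : R) /\
      box a' b' [tuple of behead t]].
  apply/seteqP; split=> t.
    move=> h; split; first by rewrite /= in_itv/=; apply/andP; exact: h ord0.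
    move=> i; rewrite tnth_behead (_ : inord _ = lift ord0 i); first exact: h.
    by apply/val_inj; rewrite /= inordK// ltnS.
  move=> [/= h0 h] i; case: (unliftP ord0 i) => [j ->|->].
    have := h j; rewrite tnth_behead (_ : inord _ = lift ord0 j)//.
    by apply/val_inj; rewrite /= inordK// ltnS.
  by move: h0; rewrite in_itv => /andP.
rewrite lebesgue_tupleSE//; last exact: measurable_box.
apply: mule_gt0; last by apply: IH => i; exact: ab.
by rewrite lebesgue_measure_itv/= lte_fin ab -EFinD lte_fin subr_gt0.
Qed.

Lemma torus_projT (p : torus R d) : exists2 t, @cell R d t & torus_proj t = p.
Proof.
have pi2 : 0 < 2 * pi :> R by rewrite mulr_gt0// pi_gt0.
pose x : 'rV[R]_d := repr p.
pose k i : int := Num.floor (x 0 i / (2 * pi)).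
pose y i : R := x 0 i - 2 * pi * (k i)%:~R.
exists [tuple y i | i < d] => [i|].
  rewrite tnth_mktuple /y; split.
    by rewrite subr_ge0 -ler_pdivlMl// mulrC ge_floor.
  have := lt_succ_floor (x 0 i / (2 * pi)).
  by rewrite ltr_pdivrMr// intrD mulrDl mul1r -/(k i) mulrC addrC ltrBlDr.
rewrite /torus_proj -[RHS]reprK; apply/eqmodP/asboolP.
exists (fun i => - k i) => i.
by rewrite mxE tnth_mktuple /y addrC addKr rmorphN mulrN.
Qed.

(** Applied to neighbourhoods of the extreme level sets of [omega], for the behaviour at zero mass
    and for the uniqueness of the parameters. *)
Lemma torus_lebesgue_open_gt0 (U : set (torus R d)) :
  open U -> U !=set0 -> (0 < @torus_lebesgue R d U)%E.
Proof.
move=> oU [p Up]; have [t ct tp] := torus_projT p.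
pose row_of (t : d.-tuple mR) : 'rV[R]_d := \row_i (tnth t i : R).
have Vt : nbhs (row_of t) (\pi_(torus R d)%qT @^-1` U).
  by apply: open_nbhs_nbhs; split; [exact: oU|rewrite /= -tp in Up *].
have [e /= e0 eV] := (@nbhs_ballP _ _ _ _).1 Vt.
(* [t] may lie on a lower face of the cell, so the box extends only upwards from [t]; the minimum
   with [2 pi] keeps it in the cell. *)
pose b i := Num.min (tnth t i + e : R) (2 * pi).
have sub : box (fun i => tnth t i) b `<=` @torus_proj R d @^-1` U `&` @cell R d.
  move=> u hu; split.
    apply: eV; split => // i j; rewrite !ord1 /ball/= !mxE.
    have [h1 h2] := hu j.
    rewrite ltr_distlC; apply/andP; split; first by rewrite (lt_le_trans _ h1)// ltrBlDr ltrDl.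
    by rewrite (lt_le_trans h2)// ge_min lexx.
  move=> i; have [h1 h2] := hu i; split.
    by rewrite (le_trans _ h1)//; have [] := ct i.
  by rewrite (lt_le_trans h2)// ge_min lexx orbT.
apply: (lt_le_trans (@lebesgue_box_gt0 _ (fun i => tnth t i) b _)).
  by move=> i; rewrite lt_min ltrDl e0; have [] := ct i.
rewrite /torus_lebesgue /pushforward /mrestr le_measure ?inE//.
- exact: measurable_box.
- apply: measurableI; last exact: measurable_cell.
  rewrite -[X in measurable X]setTI; apply: measurable_torus_proj => //.
  exact: sub_sigma_algebra.
Qed.

End torus_lebesgue_support.

Section density_measure.
Local Open Scope ereal_scope.
Context d (T : measurableType d) (R : realType).
Variables (mu : {measure set T -> \bar R}) (f : T -> \bar R).

(* The hypotheses on [f] are arguments so that the measure structure can be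
   inferred from the term. *)
Definition density_measure of (forall p, 0 <= f p) & measurable_fun setT f
    & \int[mu]_p f p < +oo :=
  fun A : set T => \int[mu]_(p in A) f p.

Hypotheses (f0 : forall p, 0 <= f p) (mf : measurable_fun setT f).
Hypothesis If : \int[mu]_p f p < +oo.

Local Notation nu := (density_measure f0 mf If).

Let nu0 : nu set0 = 0.
Proof. exact: integral_set0. Qed.

Let nu_ge0 A : 0 <= nu A.
Proof. exact: integral_ge0. Qed.

Let nu_sigma_additive : semi_sigma_additive nu.
Proof.
move=> F mF tF mUF; rewrite /density_measure ge0_integral_bigcup//.
  by apply: is_cvg_ereal_nneg_natsum => n _; exact: integral_ge0.
exact: measurable_funTS.
Qed.

HB.instance Definition _ := isMeasure.Build _ _ _ nu
  nu0 nu_ge0 nu_sigma_additive.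

Let nu_fin : fin_num_fun nu.
Proof.
move=> A mA; rewrite ge0_fin_numE// (le_lt_trans _ If)//.
by rewrite /density_measure ge0_subset_integral.
Qed.

HB.instance Definition _ := Measure_isFinite.Build _ _ _ nu nu_fin.

End density_measure.

Section change_of_density.
Local Open Scope ereal_scope.
Context d (T : measurableType d) (R : realType).
Variables (mu : {sigma_finite_measure set T -> \bar R}) (f : T -> \bar R).
Hypotheses (f0 : forall p, 0 <= f p) (mf : measurable_fun setT f).
Hypothesis If : \int[mu]_p f p < +oo.

(** The Radon-Nikodym derivative of [nu] agrees with [f] almost everywhere, since both integrate to
    [nu]; the change of variables is known for that derivative. *)
Lemma integral_density_measure (phi : T -> \bar R) :
  (forall p, 0 <= phi p) -> measurable_fun setT phi ->
  \int[density_measure f0 mf If]_p phi p = \int[mu]_p (phi p * f p).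
Proof.
move=> phi0 mphi; set nu := density_measure f0 mf If.
have numu : nu `<< mu.
  apply/null_content_dominatesP => A mA muA0.
  rewrite /nu /density_measure -(integral_abs_eq0 mA (measurable_funTS mf) muA0).
  by apply: eq_integral => p _; rewrite gee0_abs.
have If' : mu.-integrable setT f.
  apply/integrableP; split => //.
  by under eq_integral do rewrite gee0_abs//.
pose h := Radon_Nikodym_SigmaFinite.f nu mu.
have Ih : mu.-integrable setT h by exact: Radon_Nikodym_SigmaFinite.f_integrable.
rewrite -(@Radon_Nikodym_SigmaFinite.change_of_variables _ _ _ nu mu numu)//.
apply: ge0_ae_eq_integral => //.
- by apply: emeasurable_funM => //; exact: measurable_int Ih.
- exact: emeasurable_funM.
- by move=> p _; rewrite mule_ge0// Radon_Nikodym_SigmaFinite.f_ge0.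
- by move=> p _; rewrite mule_ge0.
apply: ae_eqe_mul2l; apply: integral_ae_eq => // E _ mE.
by rewrite -Radon_Nikodym_SigmaFinite.f_integral.
Qed.

End change_of_density.

Section torus_measures.
Variables (R : realType) (d : nat).
Local Notation torus := (torus R d).
Local Notation dp := (@torus_lebesgue R d).
Local Open Scope ereal_scope.

Let torus_lebesgue_fin : fin_num_fun dp.
Proof.
move=> A mA; rewrite ge0_fin_numE//; apply: (@le_lt_trans _ _ (dp setT)).
  by rewrite le_measure ?inE.
by rewrite torus_lebesgueT ltry.
Qed.

HB.instance Definition _ := Measure_isFinite.Build _ _ _ dp torus_lebesgue_fin.

Lemma torus_lebesgue_gt0 : 0 < dp setT.
Proof. by rewrite torus_lebesgueT lte_fin exprn_gt0// mulr_gt0// pi_gt0. Qed.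

Lemma torus_lebesgue_lty : dp setT < +oo.
Proof. by rewrite torus_lebesgueT ltry. Qed.

Implicit Types (lambda sigma : {measure set torus -> \bar R}).
Implicit Types f : torus -> \bar R.

Lemma decomposition_density_lty lambda f sigma :
  lebesgue_decomposition lambda f sigma -> lambda setT < +oo ->
  \int[dp]_p f p < +oo.
Proof.
move=> [_ _ _ dec]; rewrite dec//; apply: le_lt_trans.
by rewrite leeDl.
Qed.

Lemma integral_decomposition lambda f sigma phi :
  lebesgue_decomposition lambda f sigma -> lambda setT < +oo ->
  (forall p, 0 <= phi p) -> measurable_fun setT phi ->
  \int[lambda]_p phi p = \int[dp]_p (phi p * f p) + \int[sigma]_p phi p.
Proof.
move=> dec lty phi0 mphi; have If := decomposition_density_lty dec lty.
have [mf f0 _ lE] := dec.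
rewrite -(integral_density_measure f0 mf If)// -ge0_integral_measure_add//.
apply: eq_measure_integral => A mA _.
rewrite lE//; exact: (esym (measure_addE (density_measure f0 mf If) sigma A)).
Qed.

(** Off [N] and [N'] both singular parts vanish, so each density integrates over [E] to the measure
    of [E] without these null sets. As [ac_density] is an arbitrary choice, this is what allows
    computing the entropy from an explicit decomposition. *)
Lemma lebesgue_decomposition_unique lambda f f' sigma sigma' :
  lambda setT < +oo ->
  lebesgue_decomposition lambda f sigma ->
  lebesgue_decomposition lambda f' sigma' -> ae_eq dp setT f f'.
Proof.
move=> lty dec dec'; have If := decomposition_density_lty dec lty.
have [mf f0 [N [mN N0 sN]] lE] := dec.
have [mf' f'0 [N' [mN' N'0 sN']] lE'] := dec'.
have mNN : measurable (N `|` N') by exact: measurableU.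
have NN0 : dp (N `|` N') = 0 by exact: measureU_null.
have off (g : torus -> \bar R) (tau : {measure set torus -> \bar R}) Z E :
    lebesgue_decomposition lambda g tau -> measurable Z -> tau (~` Z) = 0 ->
    Z `<=` N `|` N' -> measurable E ->
    \int[dp]_(p in E) g p = lambda (E `\` (N `|` N')).
  move=> [mg g0 _ lg] mZ tZ ZN mE.
  have mD : measurable (E `\` (N `|` N')) by exact: measurableD.
  rewrite lg// (_ : tau _ = 0) ?adde0.
    by rewrite [LHS](ge0_negligible_integral mNN)//; exact: measurable_funTS.
  apply: (subset_measure0 mD _ _ tZ); first exact: measurableC.
  by move=> p [_ Np] Zp; apply: Np; exact: ZN.
apply: integral_ae_eq => //.
  apply/integrableP; split => //.
  by under eq_integral do rewrite gee0_abs//.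
move=> E _ mE; rewrite (off _ _ _ _ dec mN sN)//.
by rewrite (off _ _ _ _ dec' mN' sN').
Qed.

End torus_measures.

(** * Maximization of the entropy *)

Section entropy_maximization.
Variables (R : realType) (d : nat).
Local Notation torus := (torus R d).
Local Notation dp := (@torus_lebesgue R d).
Variable omega : torus -> R.
Hypothesis momega : measurable_fun setT omega.
Hypothesis omega01 : forall p, 0 <= omega p <= 1.
Variables mu nu : R.

Let theta p := mu * omega p + nu.

Hypothesis theta_ge0 : forall p, 0 <= theta p.
Hypothesis theta_null : dp [set p | theta p = 0] = 0%E.
Variables M0 E0 : R.

Local Notation g := (bose_einstein omega mu nu).
Local Notation h := (@bose_entropy R).

Let mtheta : measurable_fun setT theta.
Proof. by apply: measurable_funD => //; exact: measurable_funM. Qed.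

Let mN : measurable [set p | theta p = 0].
Proof. exact: measurable_level. Qed.

Let theta_gt0 p : ~ [set p | theta p = 0] p -> 0 < theta p.
Proof. by move=> /eqP tn0; rewrite lt_neqAle eq_sym tn0 theta_ge0. Qed.

Let mbose : measurable_fun setT (fun p => bose (theta p)).
Proof. by apply: measurableT_comp; [exact: measurable_bose|]. Qed.

Lemma bose_einsteinE p : theta p != 0 -> g p = (bose (theta p))%:E.
Proof.
move=> t0; rewrite /bose_einstein inver ifF// -expR0 subr_eq0.
by apply/negbTE; rewrite (inj_eq (@expR_inj R)).
Qed.

Lemma measurable_bose_einstein : measurable_fun setT g.
Proof.
have -> : g = (fun p => if theta p == 0 then +oo%E else (bose (theta p))%:E).
  apply/funext => p; case: ifPn => [/eqP t0|]; last exact: bose_einsteinE.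
  by rewrite /bose_einstein -/(theta p) t0 expR0 subrr inver eqxx.
apply: measurable_fun_ifT => //; last exact/measurable_EFinP.
exact: measurable_fun_eqr.
Qed.

Lemma bose_einstein_ge0 p : (0 <= g p)%E.
Proof.
by rewrite /bose_einstein inve_ge0 lee_fin subr_ge0 -expR0 ler_expR theta_ge0.
Qed.

Lemma bose_einstein_ae : ae_eq dp setT g (fun p => (bose (theta p))%:E).
Proof.
exists [set p | theta p = 0]; split => // p /= /not_implyP[_] gp.
by apply: contrapT => /eqP /bose_einsteinE.
Qed.

Lemma integral_bose_einstein (w : torus -> R) : measurable_fun setT w ->
  (forall p, 0 <= w p) ->
  (\int[dp]_p ((w p)%:E * g p) = \int[dp]_p (w p * bose (theta p))%:E)%E.
Proof.
move=> mw w0; apply: ge0_ae_eq_integral => //.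
- apply: emeasurable_funM; first exact/measurable_EFinP.
  exact: measurable_bose_einstein.
- by apply/measurable_EFinP; exact: measurable_funM.
- by move=> p _; rewrite mule_ge0 ?lee_fin// bose_einstein_ge0.
- by move=> p _; rewrite lee_fin mulr_ge0// bose_ge0.
under [X in ae_eq _ _ _ X]eq_fun do rewrite EFinM.
by apply: ae_eqe_mul2l; exact: bose_einstein_ae.
Qed.

Lemma integral_bose_einstein1 :
  (\int[dp]_p g p = \int[dp]_p (bose (theta p))%:E)%E.
Proof.
transitivity (\int[dp]_p ((cst 1%R p)%:E * g p))%E.
  by apply: eq_integral => p _; rewrite mul1e.
rewrite integral_bose_einstein//.
by apply: eq_integral => p _; rewrite mul1r.
Qed.

Hypothesis g_lty : (\int[dp]_p g p < +oo)%E.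

Let Ib : dp.-integrable setT (EFin \o (fun p => bose (theta p))).
Proof.
apply: ge0_integrable_fin => //; first by move=> p; exact: bose_ge0.
by rewrite -integral_bose_einstein1.
Qed.

Let l p := ln (1 + bose (theta p)).

Let l_ge0 p : 0 <= l p.
Proof. by rewrite ln_ge0// lerDl bose_ge0. Qed.

Let Il : dp.-integrable setT (EFin \o l).
Proof.
apply: (le_integrable measurableT _ _ Ib).
  apply/measurable_EFinP; apply: measurableT_comp => //.
  exact: measurable_funD.
move=> p _ /=; have b0 : 0 <= bose (theta p) by exact: bose_ge0.
rewrite lee_fin !ger0_norm//; apply: le_ln1Dx.
by rewrite (lt_le_trans _ b0)// ltrN10.
Qed.

Let J := (\int[dp]_p (l p)%:E)%E.

Let J_fin : J \is a fin_num.
Proof. exact: integrable_fin_num Il. Qed.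

Implicit Types lambda sigma : {measure set torus -> \bar R}.

Let K : R := mu * E0 + nu * M0.

(** [mu] and [nu] act as Lagrange multipliers: the constraints enter the entropy bound through this
    value, common to all competitors. *)
Lemma integral_theta lambda : mass lambda = M0%:E ->
  energy omega lambda = E0%:E -> (\int[lambda]_p (theta p)%:E = K%:E)%E.
Proof.
move=> massE energyE; have lty : (lambda setT < +oo)%E.
  by move: massE; rewrite /mass => ->; rewrite ltry.
have Iw : lambda.-integrable setT (EFin \o omega).
  exact: (bounded_integrable lty (c := 1)).
have Iz := integrableZl measurableT mu Iw.
rewrite (@integralD_EFin _ _ _ _ _ measurableT (fun p => mu * omega p) (cst nu))//; last first.
  exact: integrable_cstr.
rewrite (_ : \int[lambda]_p (mu * omega p)%:E = mu%:E * energy omega lambda)%E; last first.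
  by rewrite /energy -integralZl.
rewrite energyE (_ : \int[lambda]_p (cst nu p)%:E = nu%:E * mass lambda)%E; last first.
  exact: (integral_cst lambda measurableT nu%:E).
by rewrite massE.
Qed.

Lemma measurable_entropy_density f : measurable_fun setT f ->
  measurable_fun setT (fun p : torus => h (fine (f p))).
Proof.
move=> mf; apply: measurableT_comp; first exact: measurable_bose_entropy.
by apply: measurableT_comp => //; exact: fine_measurable.
Qed.

Let tangent f p : (forall p, 0 <= f p)%E -> ~ [set p | theta p = 0] p ->
  h (fine (f p)) <= theta p * fine (f p) + l p ?= iff (fine (f p) == bose (theta p)).
Proof.
by move=> f0 /theta_gt0 t0; apply: bose_entropy_tangent => //; exact: fine_ge0.
Qed.

(** Where the density is [+oo], [fine] returns 0, so in general only an inequality holds. *)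
Let fine_mul_le (f : torus -> \bar R) p : (0 <= f p)%E ->
  ((theta p * fine (f p))%:E <= (theta p)%:E * f p)%E.
Proof.
move=> f0; have [fy|] := eqVneq (f p) +oo%E.
  by rewrite fy /= mulr0 mule_ge0// lee_fin.
by move=> fy; rewrite EFinM fineK// ge0_fin_numE// ltey.
Qed.

Lemma entropy_density_le f : measurable_fun setT f -> (forall p, 0 <= f p)%E ->
  (\int[dp]_p (h (fine (f p)))%:E <= \int[dp]_p ((theta p)%:E * f p) + J)%E.
Proof.
move=> mf f0; rewrite -ge0_integralD//; last 4 first.
- by move=> p _; rewrite mule_ge0// lee_fin.
- by apply: emeasurable_funM => //; exact/measurable_EFinP.
- by move=> p _; rewrite lee_fin.
- exact: measurable_int Il.
have mt : measurable_fun setT (fun p => (theta p)%:E * f p + (l p)%:E)%E.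
  apply: emeasurable_funD; last exact: measurable_int Il.
  by apply: emeasurable_funM => //; exact/measurable_EFinP.
apply: ae_ge0_le_integral => //.
- by move=> p _; rewrite lee_fin bose_entropy_ge0// fine_ge0.
- by apply/measurable_EFinP; exact: measurable_entropy_density.
- by move=> p _; rewrite adde_ge0 ?lee_fin// mule_ge0// lee_fin.
exists [set p | theta p = 0]; split => // p /=; apply: contra_notP => tp _.
apply: (@le_trans _ _ ((theta p * fine (f p))%:E + (l p)%:E)%E).
  by rewrite -EFinD lee_fin; have [] := tangent f0 tp.
by rewrite leeD2r// fine_mul_le.
Qed.

Lemma quantum_entropy_le lambda : mass lambda = M0%:E ->
  energy omega lambda = E0%:E -> (quantum_entropy lambda <= K%:E + J)%E.
Proof.
move=> massE energyE; rewrite /quantum_entropy /ac_density.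
have lty : (lambda setT < +oo)%E by move: massE; rewrite /mass => ->; rewrite ltry.
have thetaE := integral_theta massE energyE.
have J0 : (0 <= J)%E by apply: integral_ge0 => p _; rewrite lee_fin.
have K0 : (0 <= K%:E)%E.
  by rewrite -thetaE; apply: integral_ge0 => p _; rewrite lee_fin.
case: xgetP => [f _ [sigma dec]|_].
  have [mf f0 _ _] := dec; apply: (le_trans (entropy_density_le mf f0)).
  rewrite leeD2r// -thetaE (integral_decomposition dec)//.
  - by rewrite leeDl// integral_ge0// => p _; rewrite lee_fin.
  - exact/measurable_EFinP.
apply: le_trans (adde_ge0 K0 J0); rewrite integral0_eq// => p _ /=.
by rewrite /bose_entropy addr0 ln1 !mulr0 mul0r subr0.
Qed.

Lemma quantum_entropy_eq lambda sigma : mass lambda = M0%:E ->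
  lebesgue_decomposition lambda g sigma ->
  (\int[sigma]_p (theta p)%:E = 0)%E -> energy omega lambda = E0%:E ->
  quantum_entropy lambda = (K%:E + J)%E.
Proof.
move=> massE dec sigma0 energyE.
have lty : (lambda setT < +oo)%E by move: massE; rewrite /mass => ->; rewrite ltry.
have thetaE := integral_theta massE energyE.
rewrite /quantum_entropy /ac_density; case: xgetP => [f _ [sigma' dec']|]; last first.
  by move=> /(_ g)[]; exists sigma.
have fg := lebesgue_decomposition_unique lty dec' dec.
have [mf f0 _ _] := dec'.
rewrite -thetaE (integral_decomposition dec)//; last exact/measurable_EFinP.
rewrite sigma0 adde0 integral_bose_einstein// -ge0_integralD//; last 4 first.
- by move=> p _; rewrite lee_fin mulr_ge0// bose_ge0.
- by apply/measurable_EFinP; exact: measurable_funM.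
- by move=> p _; rewrite lee_fin.
- exact: measurable_int Il.
apply: ge0_ae_eq_integral => //.
- by apply/measurable_EFinP; exact: measurable_entropy_density.
- apply: emeasurable_funD; last exact: measurable_int Il.
  by apply/measurable_EFinP; exact: measurable_funM.
- by move=> p _; rewrite lee_fin bose_entropy_ge0// fine_ge0.
- by move=> p _; rewrite adde_ge0// lee_fin// mulr_ge0// bose_ge0.
have [Z [mZ Z0 Zsub]] : ae_eq dp setT f (fun p => (bose (theta p))%:E).
  exact: ae_eq_trans fg bose_einstein_ae.
exists (Z `|` [set p | theta p = 0]); split; first exact: measurableU.
  exact: measureU_null.
move=> p /= /not_implyP[_] hp; have [Zp|Zp] := pselect (Z p); [by left|right].
apply: contrapT => tp; apply: hp.
have fp : f p = (bose (theta p))%:E.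
  by apply: contrapT => fp; apply: Zp; apply: Zsub => /= /(_ Logic.I).
have := tangent f0 tp; rewrite fp /= => -[_]; rewrite eqxx => /eqP ->.
by rewrite EFinD.
Qed.

(** With [A] and [S] the integrals of [theta] against the two parts, [A + S = K], while the entropy
    bound forces [K <= A]; so [S = 0] and [A = K]. The deficit [k] in the tangent inequality is then
    nonnegative almost everywhere with integral zero, and the equality case identifies [f]. *)
Lemma quantum_entropy_eq_inv lambda f sigma : mass lambda = M0%:E ->
  energy omega lambda = E0%:E -> lebesgue_decomposition lambda f sigma ->
  (\int[dp]_p (h (fine (f p)))%:E = K%:E + J)%E ->
  ae_eq dp setT f g /\ (\int[sigma]_p (theta p)%:E = 0)%E.
Proof.
move=> massE energyE dec HE.
have lty : (lambda setT < +oo)%E by move: massE; rewrite /mass => ->; rewrite ltry.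
have [mf f0 _ _] := dec.
have mft : measurable_fun setT (fun p => (theta p)%:E * f p)%E.
  by apply: emeasurable_funM => //; exact/measurable_EFinP.
have := integral_theta massE energyE.
rewrite (integral_decomposition dec)//; last exact/measurable_EFinP.
set A := (\int[dp]_p _)%E; set S := (\int[sigma]_p _)%E => AS.
have A0 : (0 <= A)%E by apply: integral_ge0 => p _; rewrite mule_ge0// lee_fin.
have S0 : (0 <= S)%E by apply: integral_ge0 => p _; rewrite lee_fin.
have Afin : A \is a fin_num.
  rewrite ge0_fin_numE// (@le_lt_trans _ _ (A + S)%E) ?leeDl//.
  by rewrite AS ltry.
have KA : (K%:E <= A)%E.
  by rewrite -(@leeD2rE _ J)// -HE; exact: entropy_density_le.
have SE : S = 0%E.
  apply/eqP; rewrite eq_le S0 andbT -(@leeD2lE _ A)// AS adde0.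
  exact: KA.
split => //.
have AK : A = K%:E by rewrite -AS SE adde0.
have Ify := decomposition_density_lty dec lty.
have If : dp.-integrable setT f.
  by apply/integrableP; split => //; under eq_integral do rewrite gee0_abs//.
have [Z [mZ Z0 Zsub]] := integrable_ae measurableT If.
have mfine : measurable_fun setT (fun p => fine (f p)).
  by apply: measurableT_comp => //; exact: fine_measurable.
have A' : (\int[dp]_p (theta p * fine (f p))%:E = A)%E.
  apply: ge0_ae_eq_integral => //.
  - by apply/measurable_EFinP; exact: measurable_funM.
  - by move=> p _; rewrite lee_fin mulr_ge0// fine_ge0.
  - by move=> p _; rewrite mule_ge0// lee_fin.
  exists Z; split => // p /= /not_implyP[_ tp]; apply: Zsub => /= /(_ Logic.I) fp.
  by apply: tp; rewrite EFinM fineK.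
have I1 : dp.-integrable setT (EFin \o (fun p => theta p * fine (f p))).
  apply: ge0_integrable_fin; first exact: measurable_funM.
    by move=> p; rewrite mulr_ge0// fine_ge0.
  by rewrite A' AK ltry.
have I2 : dp.-integrable setT (EFin \o (fun p => h (fine (f p)))).
  apply: ge0_integrable_fin; first exact: measurable_entropy_density.
    by move=> p; rewrite bose_entropy_ge0// fine_ge0.
  by rewrite HE -(fineK J_fin) -EFinD ltry.
pose k p := theta p * fine (f p) + l p - h (fine (f p)).
have I12 : dp.-integrable setT (EFin \o (fun p => theta p * fine (f p) + l p)).
  by have := integrableD measurableT I1 Il; apply: eq_integrable.
have Ik : dp.-integrable setT (EFin \o k).
  by have := integrableB measurableT I12 I2; apply: eq_integrable.
have k0 p : ~ [set p | theta p = 0] p -> 0 <= k p.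
  by move=> tp; rewrite subr_ge0; have [] := tangent f0 tp.
have : (\int[dp]_p `|(k p)%:E| = 0)%E.
  transitivity (\int[dp]_p (k p)%:E)%E.
    apply: ae_eq_integral => //.
    - by apply: measurableT_comp => //; exact: measurable_int Ik.
    - exact: measurable_int Ik.
    exists [set p | theta p = 0]; split => // p /= /not_implyP[_].
    by apply: contra_notP => /k0 kp; rewrite ger0_norm.
  rewrite integralB_EFin// integralD_EFin// A' -/J HE AK.
  by rewrite subee// fin_numD J_fin.
move/ae_eq_integral_abs => /(_ measurableT (measurable_int _ Ik))[Y [mY Y0 Ysub]].
exists (Y `|` (Z `|` [set p | theta p = 0])); split.
- by do 2?apply: measurableU.
- apply: measureU_null => //; first exact: measurableU.
  exact: measureU_null.
move=> p /= /not_implyP[_] fg; have [Yp|Yp] := pselect (Y p); [by left|right].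
have [Zp|Zp] := pselect (Z p); [by left|right].
apply: contrapT => tp; apply: fg.
have kp : k p = 0.
  by apply: contrapT => kp; apply: Yp; apply: Ysub => /= /(_ Logic.I)[].
have fp : f p \is a fin_num.
  by apply: contrapT => fp; apply: Zp; apply: Zsub => /= /(_ Logic.I).
have [_] := tangent f0 tp.
have -> : h (fine (f p)) = theta p * fine (f p) + l p.
  by apply/esym/eqP; rewrite -subr_eq0 -/(k p) kp.
rewrite eqxx => /esym/eqP fb.
by rewrite bose_einsteinE -?fb ?fineK//; exact/eqP.
Qed.

(** A measure without a Lebesgue decomposition has entropy 0; strict positivity of the optimal value
    prevents it from being a maximizer. *)
Let entropy_max_gt0 lambda : mass lambda = M0%:E -> energy omega lambda = E0%:E ->
  (0 < K%:E + J)%E.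
Proof.
move=> massE energyE; have := integral_theta massE energyE => thetaE.
have K0 : (0 <= K%:E)%E.
  by rewrite -thetaE; apply: integral_ge0 => p _; rewrite lee_fin.
rewrite (@lt_le_trans _ _ J)//; last by rewrite leeDr.
rewrite -(fineK J_fin) lte_fin.
have := @lt_Rintegral _ _ _ dp (torus_lebesgue_gt0 R d) _ (cst 0) l theta_null _ Il mN.
rewrite Rintegral_cst// mul0r; apply => //.
  exact: (integrable_cstr (torus_lebesgue_lty R d)).
by move=> p /theta_gt0 tp; rewrite ln_gt0// ltrDl bose_gt0.
Qed.

Lemma equilibrium_maximizes lambda sigma : mass lambda = M0%:E ->
  energy omega lambda = E0%:E -> lebesgue_decomposition lambda g sigma ->
  (\int[sigma]_p (theta p)%:E = 0)%E -> entropy_maximizer omega M0 E0 lambda.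
Proof.
move=> massE energyE dec sigma0; split; [exact: massE|exact: energyE|].
move=> lambda' mass' energy'; rewrite (quantum_entropy_eq massE dec sigma0 energyE).
exact: quantum_entropy_le.
Qed.

(** [lambda0] shows that the bound is attained, so every maximizer attains it, and the equality case
    fixes its density up to a null set. That null set does not affect integrals, so [g] itself may
    replace the density. *)
Lemma maximizer_density lambda0 sigma0 lambda : mass lambda0 = M0%:E ->
  energy omega lambda0 = E0%:E -> lebesgue_decomposition lambda0 g sigma0 ->
  (\int[sigma0]_p (theta p)%:E = 0)%E -> entropy_maximizer omega M0 E0 lambda ->
  exists2 sigma : {measure set torus -> \bar R},
    lebesgue_decomposition lambda g sigma & (\int[sigma]_p (theta p)%:E = 0)%E.
Proof.
move=> mass0 energy0 dec0 sigma00 [massE energyE maxE].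
have HE : quantum_entropy lambda = (K%:E + J)%E.
  apply/eqP; rewrite eq_le quantum_entropy_le//=.
  rewrite -(quantum_entropy_eq mass0 dec0 sigma00 energy0).
  exact: maxE mass0 energy0.
move: HE; rewrite /quantum_entropy /ac_density.
case: xgetP => [f _ [sigma dec]|_] HE; last first.
  have := entropy_max_gt0 mass0 energy0; rewrite -HE integral0_eq ?ltxx// => p _ /=.
  by rewrite /bose_entropy addr0 ln1 !mulr0 mul0r subr0.
have [fg sigmaE] := quantum_entropy_eq_inv massE energyE dec HE.
exists sigma => //; have [mf f0 sing lE] := dec; split => //.
- exact: measurable_bose_einstein.
- exact: bose_einstein_ge0.
move=> A mA; rewrite lE//; congr (_ + _)%E.
apply: ae_eq_integral => //.
- exact: measurable_funTS.
- by apply: measurable_funTS; exact: measurable_bose_einstein.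
- exact: ae_eq_subset fg.
Qed.

End entropy_maximization.

(** * Condensation on a boundary curve *)

Section gap_function.
Context d (T : measurableType d) (R : realType).
Variable mu : {measure set T -> \bar R}.
Hypothesis muT_gt0 : (0 < mu setT)%E.
Hypothesis muT_lty : (mu setT < +oo)%E.
Variable s : T -> R.
Hypothesis ms : measurable_fun setT s.
Hypothesis s_ge0 : forall p, 0 <= s p.
Hypothesis s_le1 : forall p, s p <= 1.
Hypothesis s_null : mu [set p | s p = 0] = 0%E.
Hypothesis s_full : forall e, 0 < e -> (0 < mu [set p | (s p < e)%R])%E.

Local Notation g := (gap mu s).
Local Notation V := (fine (mu setT)).

Let integrable_or : mu.-integrable setT (EFin \o (fun p => (s p)^-1)) \/ g = cst 0.
Proof.
have [|N] := pselect (mu.-integrable setT (EFin \o (fun p => (s p)^-1))); first by left.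
by right; apply/funext => m; rewrite gap_infinite.
Qed.

Lemma integral_inve : (\int[mu]_p ((s p)%:E)^-1 = \int[mu]_p ((s p)^-1)%:E)%E.
Proof.
have mN : measurable [set p | s p = 0] by exact: measurable_level.
apply: ge0_ae_eq_integral => //.
- have -> : (fun p => ((s p)%:E)^-1)%E =
      (fun p => if s p == 0 then +oo%E else ((s p)^-1)%:E).
    by apply/funext => p; rewrite inver.
  apply: measurable_fun_ifT => //; first exact: measurable_fun_eqr.
  by apply/measurable_EFinP; exact: (measurableT_comp (@measurable_invr R)).
- by apply/measurable_EFinP; exact: (measurableT_comp (@measurable_invr R)).
- by move=> p _; rewrite inve_ge0 lee_fin.
- by move=> p _; rewrite lee_fin invr_ge0.
exists [set p | s p = 0]; split => // p /= /not_implyP[_]; apply: contra_notP.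
by move=> /eqP/negbTE s0; rewrite inver s0.
Qed.

Lemma integrable_invP : (\int[mu]_p ((s p)%:E)^-1 < +oo)%E <->
  mu.-integrable setT (EFin \o (fun p => (s p)^-1)).
Proof.
rewrite integral_inve; split => [|/(integrable_fin_num measurableT)]; last first.
  by rewrite ge0_fin_numE// integral_ge0// => p _; rewrite lee_fin invr_ge0.
apply: ge0_integrable_fin; last by move=> p; rewrite invr_ge0.
exact: (measurableT_comp (@measurable_invr R)).
Qed.

Lemma derivable_gap_gt0 m : 0 < m -> derivable g m 1.
Proof.
have [Iinv|->] := integrable_or; first exact: derivable_gap.
by move=> _; exact: derivable_cst.
Qed.

Lemma gap_div_cvg0 : g h / h @[h --> 0^'+] --> 0.
Proof.
have [Iinv|->] := integrable_or; first exact: gap_cvg0.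
by under eq_fun do rewrite mul0r; exact: cvg_cst.
Qed.

Lemma gap_ge0 m : 0 <= m -> 0 <= g m.
Proof.
have [Iinv|->//] := integrable_or.
rewrite le_eqVlt => /predU1P[<-|m0]; first by rewrite gap0.
by rewrite -(gap0 mu s) ltW// gap_lt.
Qed.

Lemma gap_le x y : 0 <= x -> x <= y -> g x <= g y.
Proof.
have [Iinv|->//] := integrable_or.
by move=> x0; rewrite le_eqVlt => /predU1P[->//|xy]; rewrite ltW// gap_lt.
Qed.

Lemma sub_gap_increasing x y : mu [set p | s p = 1] = 0%E -> 0 <= x -> x < y ->
  x - g x < y - g y.
Proof.
have [Iinv|->] := integrable_or; first exact: sub_gap_lt.
by move=> _ _ xy; rewrite !subr0.
Qed.

Lemma gap_asymptotic :
  g m / m @[m --> +oo] --> V * fine (\int[mu]_p ((s p)%:E)^-1)^-1%E.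
Proof.
have [Iinv|Ninv] := pselect (mu.-integrable setT (EFin \o (fun p => (s p)^-1))).
  have Ifin := integrable_fin_num measurableT Iinv.
  have I0 := Rintegral_inv_gt0 muT_gt0 muT_lty ms s_ge0 s_null Iinv.
  have := gap_slope muT_gt0 muT_lty ms s_ge0 s_le1 s_null Iinv.
  by rewrite integral_inve -[X in fine X^-1](fineK Ifin) inver ifF// gt_eqF.
have -> : (\int[mu]_p ((s p)%:E)^-1 = +oo)%E.
  by apply: contra_notP Ninv => /eqP; rewrite -ltey => /integrable_invP.
rewrite invey mulr0; under eq_fun do rewrite gap_infinite// mul0r.
exact: cvg_cst.
Qed.

End gap_function.

Section branch.
Variables (R : realType) (d : nat).
Local Notation torus := (torus R d).
Local Notation dp := (@torus_lebesgue R d).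
Let dpT_gt0 : (0 < dp setT)%E.
Proof. exact: torus_lebesgue_gt0. Qed.
Let dpT_lty : (dp setT < +oo)%E.
Proof. exact: torus_lebesgue_lty. Qed.
Variable omega : torus -> R.
Hypothesis momega : measurable_fun setT omega.
Hypothesis omega01 : forall p, 0 <= omega p <= 1.
(* The upper branch is [(c, b, s) = (1, -1, 1 - omega)], the lower one
   [(a, 1, omega - a)]. *)
Variables (s : torus -> R) (c b : R).
Hypothesis omegaE : forall p, omega p = c + b * s p.
Hypothesis b2 : b * b = 1.
Hypothesis ms : measurable_fun setT s.
Hypothesis s_ge0 : forall p, 0 <= s p.
Hypothesis s_le1 : forall p, s p <= 1.
Hypothesis s_null : dp [set p | s p = 0] = 0%E.
Hypothesis s_full : forall e, 0 < e -> (0 < dp [set p | (s p < e)%R])%E.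

Local Notation B t := (bose_einstein omega (b * t) (- (b * c * t))).
Local Notation f := (fun m => c * m + b * gap dp s m).

Lemma branch_theta t p : b * t * omega p + - (b * c * t) = t * s p.
Proof. by rewrite omegaE mulrDr [b * t * (b * _)]mulrACA b2 mul1r; ring. Qed.

Let theta_ge0 t p : 0 < t -> 0 <= b * t * omega p + - (b * c * t).
Proof. by move=> t0; rewrite branch_theta mulr_ge0// ltW. Qed.

Let theta_null t : 0 < t -> dp [set p | b * t * omega p + - (b * c * t) = 0] = 0%E.
Proof.
move=> t0; rewrite -s_null; congr (dp _); apply/seteqP; split => p /=; rewrite branch_theta.
  by move/eqP; rewrite mulf_eq0 gt_eqF//= => /eqP.
by move=> ->; rewrite mulr0.
Qed.

Lemma branch_mass_dens t : 0 < t ->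
  mass_dens (B t) = (\int[dp]_p (bose (t * s p))%:E)%E.
Proof.
move=> t0; rewrite /mass_dens.
rewrite (integral_bose_einstein1 momega (fun p => theta_ge0 p t0) (theta_null t0)).
by under eq_integral do rewrite branch_theta.
Qed.

Hypothesis Iinv : dp.-integrable setT (EFin \o (fun p => (s p)^-1)).

Lemma branch_massE t : 0 < t -> mass_dens (B t) = (bose_mass dp s t)%:E.
Proof.
move=> t0; rewrite branch_mass_dens//.
have I1 : dp.-integrable setT (EFin \o (fun p => cst 1 p * bose (t * s p))).
  by apply: integrable_weight_bose => // p; rewrite /= ler01 lexx.
rewrite fineK ?(integrable_fin_num measurableT I1)//.
by under [RHS]eq_integral do rewrite mul1r.
Qed.

Lemma branch_energyE t : 0 < t ->
  energy_dens omega (B t) = (c * bose_mass dp s t + b * bose_gap dp s t)%:E.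
Proof.
move=> t0; rewrite /energy_dens integral_bose_einstein ?theta_null//; last 2 first.
- by move=> p; exact: theta_ge0.
- by move=> p; have /andP[] := omega01 p.
have I1 : dp.-integrable setT (EFin \o (fun p => cst 1 p * bose (t * s p))).
  by apply: integrable_weight_bose => // p; rewrite /= ler01 lexx.
have I2 : dp.-integrable setT (EFin \o (fun p => s p * bose (t * s p))).
  by apply: integrable_weight_bose => // p; rewrite s_ge0 s_le1.
rewrite -integral_lincomb//; apply: eq_integral => p _.
by rewrite branch_theta omegaE /=; congr EFin; ring.
Qed.

Lemma branch_curve : pos_graph f =
  [set (mass_dens (B t), energy_dens omega (B t)) | t in [set t : R | 0 < t]].
Proof.
apply/seteqP; split => [_ [m /= m0 <-]|_ [t /= t0 <-]].
  have [t t0 <-] := bose_mass_surj dpT_gt0 dpT_lty ms s_ge0 s_le1 s_null Iinv m0.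
  by exists t => //; rewrite branch_massE// branch_energyE// gapE.
exists (bose_mass dp s t) => /=.
  exact: (bose_mass_gt0 dpT_gt0 dpT_lty ms s_ge0 s_le1 s_null Iinv t0).
by rewrite branch_massE// branch_energyE// gapE.
Qed.

Let b_neq0 : b != 0.
Proof. by apply: contra_eq_neq b2 => ->; rewrite mul0r eq_sym oner_eq0. Qed.

(* The excess mass [M0 - bose_mass dp s t] is carried by a Dirac mass at a
   point where [omega = c]. *)
Lemma branch_condensation (M0 E0 p0 : R) (x : torus) : 0 < M0 -> 0 < p0 ->
  p0 <= gap dp s M0 -> E0 = c * M0 + b * p0 -> s x = 0 ->
  maximizers_condense_at omega c M0 E0.
Proof.
move=> M00 p00 pg E0E sx.
have [t [t0 Pt Mt]] := gap_condensation dpT_gt0 dpT_lty ms s_ge0 s_le1 s_null Iinv M00 p00 pg.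
have g0 p : (0 <= B t p)%E by apply: bose_einstein_ge0 => q; exact: theta_ge0.
have mg : measurable_fun setT (B t).
  by apply: measurable_bose_einstein => // q; exact: theta_ge0.
have massE := branch_massE t0.
have Ig : (\int[dp]_p B t p < +oo)%E by rewrite -[ltLHS]/(mass_dens (B t)) massE ltry.
have k0 : 0 <= M0 - bose_mass dp s t by rewrite subr_ge0.
pose k := NngNum k0.
pose sigma : {measure set torus -> \bar R} := mscale k (dirac x).
pose lam : {measure set torus -> \bar R} := measure_add (density_measure g0 mg Ig) sigma.
have lamE A : lam A = (\int[dp]_(p in A) B t p + sigma A)%E.
  exact: (measure_addE (density_measure g0 mg Ig) sigma A).
have mc : measurable [set p | s p = 0] by exact: measurable_level.
have dec : lebesgue_decomposition lam (B t) sigma.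
  split => //; exists [set p | s p = 0]; split => //.
  by rewrite /sigma /= /mscale /= diracE memNset ?mule0// => /(_ sx).
have intsigma (phi : torus -> R) : measurable_fun setT phi -> (forall p, 0 <= phi p) ->
    (\int[sigma]_p (phi p)%:E = ((M0 - bose_mass dp s t) * phi x)%:E)%E.
  move=> mphi phi0; rewrite ge0_integral_mscale//; last 2 first.
  - exact/measurable_EFinP.
  - by move=> p _; rewrite lee_fin.
  rewrite integral_dirac//; last exact/measurable_EFinP.
  by rewrite diracE mem_set// mul1e -EFinM.
have lamT : mass lam = M0%:E.
  rewrite /mass lamE -[X in (X + _)%E]/(mass_dens (B t)) massE.
  rewrite /sigma /= /mscale /= diracE mem_set// mule1 -EFinD.
  by rewrite addrC subrK.
have lamy : (lam setT < +oo)%E by move: lamT; rewrite /mass => ->; rewrite ltry.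
have lamE0 : energy omega lam = E0%:E.
  rewrite /energy (integral_decomposition dec)//; last 2 first.
  - by move=> p; rewrite lee_fin; have /andP[] := omega01 p.
  - exact/measurable_EFinP.
  rewrite intsigma//; last by move=> p; have /andP[] := omega01 p.
  rewrite -[X in (X + _)%E]/(energy_dens omega (B t)) branch_energyE// -EFinD.
  by congr EFin; rewrite omegaE sx E0E Pt; ring.
have mtheta : measurable_fun setT (fun p => b * t * omega p + - (b * c * t)).
  by apply: measurable_funD => //; exact: measurable_funM.
have sigma0 : (\int[sigma]_p (b * t * omega p + - (b * c * t))%:E = 0)%E.
  by rewrite intsigma// ?branch_theta ?sx ?mulr0// => p; exact: theta_ge0.
split.
  exists lam.
  apply: (@equilibrium_maximizes _ _ _ momega omega01 (b * t) (- (b * c * t))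
    _ _ _ _ _ lam sigma) => //.
  - by move=> p; exact: theta_ge0.
  - exact: theta_null.
move=> lambda max.
have [||sigma' dec' sigma'0] := @maximizer_density _ _ _ momega omega01 (b * t) (- (b * c * t))
  _ _ _ _ Ig lam sigma lambda lamT lamE0 dec sigma0 max.
- by move=> p; exact: theta_ge0.
- exact: theta_null.
exists (B t), sigma'; split => //.
  exists (b * t), (- (b * c * t)); split => //.
    by move=> -[/eqP]; rewrite mulf_eq0 (negbTE b_neq0) gt_eqF.
  by move=> p; exact: theta_ge0.
(* Since [theta = t s] has integral zero against [sigma'], that measure lives on [s = 0], which is
   the set [omega = c]. *)
have Et : (\int[sigma']_p `|(b * t * omega p + - (b * c * t))%:E| = 0)%E.
  by rewrite -[RHS]sigma'0; apply: eq_integral => p _; rewrite gee0_abs// lee_fin theta_ge0.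
have mEt : measurable_fun setT (fun p => (b * t * omega p + - (b * c * t))%:E).
  exact/measurable_EFinP.
have [Z [mZ Z0 Zsub]] := (ae_eq_integral_abs sigma' measurableT mEt).1 Et.
have mwc : measurable [set p | omega p = c] by exact: measurable_level.
apply: (subset_measure0 _ mZ _ Z0); first exact: measurableC.
move=> p /= wc; apply: Zsub => /= /(_ Logic.I)[]; rewrite branch_theta => /eqP.
rewrite mulf_eq0 gt_eqF//= => /eqP sp; apply: wc.
by rewrite omegaE sp mulr0 addr0.
Qed.

End branch.

(** * The mass-energy diagram *)

Section halfline_functions.
Context d (T : measurableType d) (R : realType).
Variable mu : {measure set T -> \bar R}.
Hypothesis muT_gt0 : (0 < mu setT)%E.
Hypothesis muT_lty : (mu setT < +oo)%E.
Variable s : T -> R.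
Hypothesis ms : measurable_fun setT s.
Hypothesis s_ge0 : forall p, 0 <= s p.
Hypothesis s_le1 : forall p, s p <= 1.
Hypothesis s_null : mu [set p | s p = 0] = 0%E.
Hypothesis s_full : forall e, 0 < e -> (0 < mu [set p | (s p < e)%R])%E.
Variables c b : R.

Local Notation f := (fun m => c * m + b * gap mu s m).

Lemma affine_gap_differentiable : differentiable_halfline f.
Proof.
split=> [m m0|].
  have dg : derivable (gap mu s) m 1 by exact: derivable_gap_gt0.
  by apply: derivableD; apply: derivableM; [exact: derivable_cst|exact: derivable_id|
    exact: derivable_cst|exact: dg].
apply/cvg_ex; exists (c + b * 0).
apply: (@cvg_trans _ ((fun h => c + b * (gap mu s h / h)) @ 0^'+)).
  apply: near_eq_cvg; near=> h.
  have h0 : h != 0 by rewrite gt_eqF//; near: h; exact: nbhs_right_gt.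
  by rewrite gap0 !mulr0 addr0 subr0 mulrDl mulfK// mulrA.
apply: cvgD; first exact: cvg_cst.
by apply: cvgM; [exact: cvg_cst|exact: gap_div_cvg0].
Unshelve. all: end_near. Qed.

Lemma affine_gap_slope : asymptotic_slope f
  (c + b * (fine (mu setT) * fine (\int[mu]_p ((s p)%:E)^-1)^-1%E)).
Proof.
apply: (@cvg_trans _ ((fun m => c + b * (gap mu s m / m)) @ +oo)).
  apply: near_eq_cvg; near=> m.
  have m0 : m != 0 by rewrite gt_eqF//; near: m; exact: nbhs_pinfty_gt.
  by rewrite mulrDl mulfK// mulrA.
apply: cvgD; first exact: cvg_cst.
by apply: cvgM; [exact: cvg_cst|exact: gap_asymptotic].
Unshelve. all: end_near. Qed.

Lemma sub_gap_increasing_halfline : mu [set p | s p = 1] = 0%E ->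
  increasing_halfline (fun m => 1 * m + -1 * gap mu s m).
Proof.
move=> s1 x y x0 xy.
have : x - gap mu s x < y - gap mu s y by exact: sub_gap_increasing.
by move: (gap mu s x) (gap mu s y) => gx gy; rewrite !mul1r !mulN1r.
Qed.

Lemma add_gap_nondecreasing_halfline : 0 <= c ->
  nondecreasing_halfline (fun m => c * m + 1 * gap mu s m).
Proof.
move=> c0 x y x0 xy; apply: lerD; first exact: ler_wpM2l.
by apply: (ler_wpM2l ler01); exact: gap_le.
Qed.

(** Either the linear term or the gap is strictly increasing. If [c = 0] and [1 / s] is not
    integrable, the function is identically 0. *)
Lemma add_gap_increasing_halfline : 0 <= c ->
  0 < c \/ (\int[mu]_p ((s p)%:E)^-1 < +oo)%E ->
  increasing_halfline (fun m => c * m + 1 * gap mu s m).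
Proof.
move=> c0 h x y x0 xy; case: h => [c_gt0|/(integrable_invP ms s_ge0 s_null) Iinv].
  apply: ltr_leD; first by rewrite ltr_pM2l.
  by apply: (ler_wpM2l ler01); apply: gap_le => //; exact: ltW.
apply: ler_ltD; first by apply: ler_wpM2l => //; exact: ltW.
by rewrite ltr_pM2l//; exact: gap_lt.
Qed.

End halfline_functions.

(** By [gap_le_mean] on each side, the energy of the uniform density of mass [m], that is [m] times
    the mean of [w], lies between the two values. *)
Lemma gap_two_sides d (T : measurableType d) (R : realType)
    (mu : {measure set T -> \bar R}) (w : T -> R) (a m : R) :
  (0 < mu setT)%E -> (mu setT < +oo)%E -> measurable_fun setT w -> 0 <= a ->
  (forall p, a <= w p <= 1) -> mu [set p | 1 - w p = 0] = 0%E ->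
  mu [set p | w p - a = 0] = 0%E -> 0 < m ->
  a * m + 1 * gap mu (fun p => w p - a) m <= 1 * m + -1 * gap mu (fun p => 1 - w p) m.
Proof.
move=> mu0 muy mw a0 aw n1 na m0; set V := fine (mu setT).
have V0 : 0 < V by apply: fine_gt0; rewrite mu0 muy.
have w0 p : 0 <= w p by have /andP[aw' _] := aw p; exact: le_trans aw'.
have w1 p : w p <= 1 by have /andP[] := aw p.
have Iw : mu.-integrable setT (EFin \o w).
  by apply: (bounded_integrable muy (c := 1)) => // p; rewrite w0 w1.
have Ic x := integrable_cstr muy x.
have h1 : gap mu (fun p => 1 - w p) m <= (1 * V - \int[mu]_p w p) / V * m.
  rewrite -Rintegral_cst// -RintegralB//; apply: gap_le_mean => //; last exact: ltW.
  - exact: measurable_funB.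
  - by move=> p; rewrite subr_ge0.
  - by move=> p; rewrite gerBl.
have h2 : gap mu (fun p => w p - a) m <= (\int[mu]_p w p - a * V) / V * m.
  rewrite -Rintegral_cst// -RintegralB//; apply: gap_le_mean => //; last exact: ltW.
  - exact: measurable_funB.
  - by move=> p; rewrite subr_ge0; have /andP[] := aw p.
  - by move=> p; rewrite lerBlDr (le_trans (w1 p))// lerDl.
have E : (1 * V - \int[mu]_p w p) / V * m + (\int[mu]_p w p - a * V) / V * m
    = m - a * m by field; rewrite gt_eqF.
move: E h1 h2; move: (gap _ _ _) (gap _ _ _) (_ / V * m) (_ / V * m).
by move=> g2 g1 x1 x2 E h1 h2; lra.
Qed.


(** * The region between the two graphs *)

Section region.
Variable R : realType.
Variables fm fp : R -> R.
Hypothesis cfm : forall m, 0 < m -> {for m, continuous fm}.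
Hypothesis cfp : forall m, 0 < m -> {for m, continuous fp}.
Hypothesis fmp : forall m, 0 < m -> fm m <= fp m.

(** Around an interior point, vertical shifts by [e / 2] in both directions stay in the region,
    which makes the inequalities strict. Conversely, strict inequalities between continuous
    functions persist nearby. *)
Lemma interior_region_between : interior (region_between fm fp) =
  [set z | 0 < z.1 /\ fm z.1 < z.2 < fp z.1].
Proof.
apply/seteqP; split => [z zI|[x y] /= [x0 /andP[fy yf]]].
  have [z0 _] := interior_subset zI.
  move: zI => /nbhs_ballP[e /= e0 eR]; split => //.
  have out k : `|k| < e -> region_between fm fp (z.1, z.2 + k).
    move=> ke; apply: eR; split => /=; first exact: ballxx.
    by rewrite /ball/= opprD addrA subrr add0r normrN.
  have e2 : `|e / 2| < e.
    by rewrite gtr0_norm ?divr_gt0// ltr_pdivrMr// mulr_natr mulr2n ltrDl.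
  have [_ /= /andP[h1 _]] := out (- (e / 2)) (eq_ind_r (fun x => x < e) e2 (normrN _)).
  have [_ /= /andP[_ h2]] := out _ e2.
  apply/andP; split; first by rewrite (le_lt_trans h1)// ltrBlDr ltrDl divr_gt0.
  by rewrite (lt_le_trans _ h2)// ltrDl divr_gt0.
have c1 : {for (x, y), continuous (fun z : R * R => z.2 - fm z.1)}.
  apply: cvgB; first exact: cvg_snd.
  by apply: continuous_cvg; [exact: cfm|exact: cvg_fst].
have c2 : {for (x, y), continuous (fun z : R * R => fp z.1 - z.2)}.
  apply: cvgB; last exact: cvg_snd.
  by apply: continuous_cvg; [exact: cfp|exact: cvg_fst].
rewrite /interior/=; near=> z; split.
  near: z; have : {for (x, y), continuous (fun z : R * R => z.1)} by exact: cvg_fst.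
  by move/cvgr_gt; apply.
apply/andP; split; rewrite -subr_ge0 ltW//.
  by near: z; move/cvgr_gt : c1; apply; rewrite subr_gt0.
by near: z; move/cvgr_gt : c2; apply; rewrite subr_gt0.
Unshelve. all: end_near. Qed.

Lemma above_region_between : above (region_between fm fp) =
  [set z | 0 < z.1 /\ fp z.1 <= z.2].
Proof.
apply/seteqP; split => -[x y] /= [x0 h]; split => //=.
  by apply: h; split => //=; rewrite lexx fmp.
by move=> E [_ /= /andP[_ Ef]]; exact: le_trans Ef h.
Qed.

Lemma below_region_between : below (region_between fm fp) =
  [set z | 0 < z.1 /\ z.2 <= fm z.1].
Proof.
apply/seteqP; split => -[x y] /= [x0 h]; split => //=.
  by apply: h; split => //=; rewrite lexx fmp.
by move=> E [_ /= /andP[fE _]]; exact: le_trans h fE.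
Qed.

End region.

(** * Equilibria without a singular part *)

Section densities.
Variables (R : realType) (d : nat).
Local Notation torus := (torus R d).
Local Notation dp := (@torus_lebesgue R d).
Variable omega : torus -> R.
Hypothesis momega : measurable_fun setT omega.
Hypothesis omega01 : forall p, 0 <= omega p <= 1.
Variables mu nu M0 E0 : R.
Hypothesis theta_ge0 : forall p, 0 <= mu * omega p + nu.
Hypothesis theta_null : dp [set p | mu * omega p + nu = 0] = 0%E.
Local Notation g := (bose_einstein omega mu nu).
Hypothesis massE : mass_dens g = M0%:E.
Hypothesis energyE : energy_dens omega g = E0%:E.

Let mg : measurable_fun setT g.
Proof. exact: measurable_bose_einstein. Qed.

Let g0 p : (0 <= g p)%E.
Proof. exact: bose_einstein_ge0. Qed.

Let Ig : (\int[dp]_p g p < +oo)%E.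
Proof. by rewrite -[ltLHS]/(mass_dens g) massE ltry. Qed.

Implicit Types lambda : {measure set torus -> \bar R}.

Lemma has_density_decomposition lambda : has_density lambda g ->
  [/\ mass lambda = M0%:E, energy omega lambda = E0%:E &
      lebesgue_decomposition lambda g mzero].
Proof.
move=> lg; have dec : lebesgue_decomposition lambda g mzero.
  split => //; first by exists set0; rewrite measure0.
  by move=> A mA; rewrite lg//; exact/esym/adde0.
have mE : mass lambda = M0%:E by rewrite /mass lg.
have lty : (lambda setT < +oo)%E by move: mE; rewrite /mass => ->; rewrite ltry.
split => //; rewrite /energy (integral_decomposition dec)//.
- by rewrite integral_measure_zero adde0.
- by move=> p; rewrite lee_fin; have /andP[] := omega01 p.
- exact/measurable_EFinP.
Qed.

Lemma has_density_maximizes lambda : has_density lambda g ->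
  entropy_maximizer omega M0 E0 lambda.
Proof.
move=> /has_density_decomposition[mE eE dec].
apply: (equilibrium_maximizes _ _ _ _ _ mE eE dec) => //.
by rewrite integral_measure_zero.
Qed.

Lemma equilibrium_has_density :
  exists lambda : {measure set torus -> \bar R}, has_density lambda g.
Proof. by exists (density_measure g0 mg Ig). Qed.

(** Here [theta] is positive everywhere, so a vanishing integral of [theta] against the singular
    part kills that part. *)
Lemma maximizer_has_density lambda : (forall p, 0 < mu * omega p + nu) ->
  entropy_maximizer omega M0 E0 lambda -> has_density lambda g.
Proof.
move=> theta_gt0 max; have [l0 /has_density_decomposition[mE eE dec]] := equilibrium_has_density.
have [|sigma [_ _ _ lE] sigma0] :=
    maximizer_density momega omega01 theta_ge0 theta_null Ig mE eE dec _ max.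
  by rewrite integral_measure_zero.
have mtheta : measurable_fun setT (fun p => mu * omega p + nu).
  by apply: measurable_funD => //; exact: measurable_funM.
have mEt : measurable_fun setT (fun p => (mu * omega p + nu)%:E) by exact/measurable_EFinP.
have Et : (\int[sigma]_p `|(mu * omega p + nu)%:E| = 0)%E.
  by rewrite -[RHS]sigma0; apply: eq_integral => p _; rewrite gee0_abs// lee_fin.
have [Z [mZ Z0 Zsub]] := (ae_eq_integral_abs sigma measurableT mEt).1 Et.
move=> A mA; rewrite lE// (_ : sigma A = 0%E) ?adde0//.
apply: (subset_measure0 mA mZ _ Z0) => p _; apply: Zsub => /= /(_ Logic.I)[] t0.
by have := theta_gt0 p; rewrite t0 ltxx.
Qed.

End densities.

(** * Consequences of the assumptions on [omega] *)

Section dispersion.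
Variables (R : realType) (d : nat).
Local Notation torus := (torus R d).
Local Notation dp := (@torus_lebesgue R d).
Variables (omega : torus -> R) (a : R).
Hypothesis omegaP : dispersion_relation omega a.

Lemma continuous_measurable_torus (f : torus -> R) :
  continuous f -> measurable_fun setT f.
Proof.
move=> /continuousP cf; apply: (measurability _ (RGenOpens.measurableE R)).
move=> _ [_ [x [y ->] <-]]; rewrite setTI; apply: sub_sigma_algebra.
by apply: cf; exact: interval_open.
Qed.

Lemma dispersion_bounds p : a <= omega p <= 1.
Proof. by have [_ _ /(_ p)] := omegaP. Qed.

Lemma dispersion_lt1 : a < 1.
Proof.
have [_ _ aw [_ [p p1]] [_ w1]] := omegaP; rewrite ltNge; apply/negP => a1.
have E : [set p | omega p = 1] = setT.
  rewrite -subTset => q _ /=; apply/le_anti.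
  by have /andP[aq ->] := aw q; rewrite (le_trans a1).
by have := torus_lebesgue_gt0 R d; rewrite -E w1 ltxx.
Qed.

Lemma dispersion_measurable : measurable_fun setT omega.
Proof. by have [cw _ _ _ _] := omegaP; exact: continuous_measurable_torus. Qed.

Lemma dispersion_near_top e : 0 < e -> (0 < dp [set p | (1 - omega p < e)%R])%E.
Proof.
move=> e0; have [cw _ _ [_ [p p1]] _] := omegaP.
apply: torus_lebesgue_open_gt0; last by exists p; rewrite /= p1 subrr.
rewrite (_ : mkset _ = omega @^-1` `]1 - e, +oo[%classic).
  by move/continuousP : cw; apply; exact: interval_open.
by apply/seteqP; split => q; rewrite /= in_itv/= andbT ltrBlDr addrC ltrBlDr.
Qed.

Lemma dispersion_near_bot e : 0 < e -> (0 < dp [set p | (omega p - a < e)%R])%E.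
Proof.
move=> e0; have [cw _ _ [[p pa] _] _] := omegaP.
apply: torus_lebesgue_open_gt0; last by exists p; rewrite /= pa subrr.
rewrite (_ : mkset _ = omega @^-1` `]-oo, a + e[%classic).
  by move/continuousP : cw; apply; exact: interval_open.
by apply/seteqP; split => q; rewrite /= in_itv/= ltrBlDl.
Qed.

Let mlevel x : measurable [set p | omega p = x].
Proof. by apply: measurable_level; exact: dispersion_measurable. Qed.

(** An affine function of [omega] that is nonnegative at both extreme values and vanishes strictly
    between them is zero. *)
Lemma equilibrium_null mu nu : (mu, nu) <> (0, 0) ->
  (forall p, 0 <= mu * omega p + nu) -> dp [set p | mu * omega p + nu = 0] = 0%E.
Proof.
move=> mn0 t0; have [_ _ _ [[p pa] [q q1]] [wa w1]] := omegaP.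
have mU : measurable ([set p | omega p = a] `|` [set p | omega p = 1]) by exact: measurableU.
have U0 : dp ([set p | omega p = a] `|` [set p | omega p = 1]) = 0%E.
  exact: measureU_null.
apply: (subset_measure0 _ mU _ U0).
  apply: measurable_level; apply: measurable_funD => //.
  by apply: measurable_funM => //; exact: dispersion_measurable.
move=> r /= tr; apply: contrapT => /not_orP[/eqP ra /eqP r1]; apply: mn0.
have /andP[ar r1'] := dispersion_bounds r.
have := t0 p; have := t0 q; rewrite pa q1 mulr1.
have {ra}ra : a < omega r by rewrite lt_neqAle eq_sym ra.
have {r1 r1'}r1 : omega r < 1 by rewrite lt_neqAle r1.
move=> h1 ha.
have nuE : nu = - (mu * omega r) by apply/eqP; rewrite -addr_eq0 addrC tr.
have mu_ge0 : 0 <= mu.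
  have : 0 <= (1 - omega r) * mu by rewrite mulrBl mul1r mulrC -nuE.
  by rewrite pmulr_rge0// subr_gt0.
have mu_le0 : mu <= 0.
  have : 0 <= (a - omega r) * mu by rewrite mulrBl mulrC [omega r * _]mulrC -nuE.
  by rewrite nmulr_rge0// subr_lt0.
have mu0 : mu = 0 by apply/le_anti; rewrite mu_ge0 mu_le0.
by rewrite nuE mu0 mul0r oppr0.
Qed.

(** Two values of [omega] determine an affine function. The sets within [e = (1 - a) / 2] of the
    maximum and of the minimum have positive measure, so each contains a point off [Z], and these
    points have different values of [omega]. *)
Lemma equilibrium_parameters_unique mu nu mu' nu' :
  ae_eq dp setT (fun p => mu * omega p + nu) (fun p => mu' * omega p + nu') ->
  mu = mu' /\ nu = nu'.
Proof.
move=> [Z [mZ Z0 Zsub]].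
have pick (A : set torus) : measurable A -> (0 < dp A)%E -> exists2 p, A p & ~ Z p.
  move=> mA; apply: contraPP => /forall2NP H; apply/negP; rewrite -leNgt measure_le0.
  apply/eqP; apply: (subset_measure0 mA mZ _ Z0) => p Ap.
  by have [//|/contrapT] := H p.
have mw := dispersion_measurable.
have eqp p : ~ Z p -> mu * omega p + nu = mu' * omega p + nu'.
  by move=> Zp; apply: contrapT => h; apply: Zp; apply: Zsub => /= /(_ Logic.I).
pose e := (1 - a) / 2; have e0 : 0 < e by rewrite divr_gt0// subr_gt0 dispersion_lt1.
have [p /= pe /eqp hp] := pick _
  (measurable_sublevel _ (measurable_funB (measurable_cst _) mw)) (dispersion_near_top e0).
have [q /= qe /eqp hq] := pick _
  (measurable_sublevel _ (measurable_funB mw (measurable_cst _))) (dispersion_near_bot e0).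
have qp : omega q < omega p by move: pe qe; rewrite /e; lra.
have h : (mu - mu') * (omega p - omega q) = 0.
  have -> : (mu - mu') * (omega p - omega q) = (mu * omega p + nu) - (mu' * omega p + nu')
     - ((mu * omega q + nu) - (mu' * omega q + nu')) by ring.
  by rewrite hp hq; ring.
have mm : mu = mu'.
  apply/eqP; rewrite -subr_eq0; move/eqP: h; rewrite mulf_eq0 => /orP[//|].
  by move=> /eqP/subr0_eq pq; move: qp; rewrite pq ltxx.
by split => //; move: hp; rewrite mm => /addrI.
Qed.

End dispersion.

(** * The three regimes *)

Section two_sides.
Variables (R : realType) (d : nat).
Local Notation torus := (torus R d).
Local Notation dp := (@torus_lebesgue R d).
Variables (omega : torus -> R) (a : R).
Hypothesis omegaP : dispersion_relation omega a.

Local Notation s1 := (fun p => 1 - omega p).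
Local Notation s2 := (fun p => omega p - a).
Local Notation fp := (fun m => 1 * m + -1 * gap dp s1 m).
Local Notation fm := (fun m => a * m + 1 * gap dp s2 m).

Let dpT_gt0 : (0 < dp setT)%E.
Proof. exact: torus_lebesgue_gt0. Qed.

Let dpT_lty : (dp setT < +oo)%E.
Proof. exact: torus_lebesgue_lty. Qed.

Let fine_dpT : fine (dp setT) = (2 * pi) ^+ d.
Proof. by rewrite torus_lebesgueT. Qed.

Let momega : measurable_fun setT omega.
Proof. exact: dispersion_measurable omegaP. Qed.

Let bounds p : a <= omega p <= 1.
Proof. exact: dispersion_bounds omegaP p. Qed.

Let a_ge0 : 0 <= a.
Proof. by have [] := omegaP. Qed.

Let a_lt1 : a < 1.
Proof. exact: dispersion_lt1 omegaP. Qed.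

Let omega01 p : 0 <= omega p <= 1.
Proof. by have /andP[aw ->] := bounds p; rewrite (le_trans a_ge0). Qed.

Let ms1 : measurable_fun setT s1.
Proof. exact: measurable_funB. Qed.

Let ms2 : measurable_fun setT s2.
Proof. exact: measurable_funB. Qed.

Let s1_ge0 p : 0 <= s1 p.
Proof. by have /andP[] := bounds p; rewrite subr_ge0. Qed.

Let s2_ge0 p : 0 <= s2 p.
Proof. by have /andP[] := bounds p; rewrite subr_ge0. Qed.

Let s1_le1 p : s1 p <= 1.
Proof. by have /andP[] := omega01 p; rewrite gerBl. Qed.

Let s2_le1 p : s2 p <= 1.
Proof. by have /andP[_ w1] := omega01 p; rewrite lerBlDr (le_trans w1)// lerDl. Qed.

Let s1_null : dp [set p | s1 p = 0] = 0%E.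
Proof.
have [_ _ _ _ [_ w1]] := omegaP; rewrite -w1; congr (dp _).
by apply/seteqP; split => p /=; [move/subr0_eq|move=> ->; rewrite subrr].
Qed.

Let s2_null : dp [set p | s2 p = 0] = 0%E.
Proof.
have [_ _ _ _ [wa _]] := omegaP; rewrite -wa; congr (dp _).
by apply/seteqP; split => p /=; [move/subr0_eq|move=> ->; rewrite subrr].
Qed.

Let s1_full e : 0 < e -> (0 < dp [set p | (s1 p < e)%R])%E.
Proof. exact: (dispersion_near_top omegaP). Qed.

Let s2_full e : 0 < e -> (0 < dp [set p | (s2 p < e)%R])%E.
Proof. exact: (dispersion_near_bot omegaP). Qed.

(** The condition means [omega = 0]: the minimal level set if [a = 0], the empty set otherwise. *)
Let s1_one : dp [set p | s1 p = 1] = 0%E.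
Proof.
have [_ _ _ _ [wa _]] := omegaP.
have E p : s1 p = 1 -> omega p = 0 by move=> /= h; lra.
have [a0|a0] := eqVneq a 0.
  rewrite -wa a0; congr (dp _); apply/seteqP; split => p /=; first exact: E.
  by move=> ->; rewrite subr0.
rewrite (_ : [set p | _] = set0) ?measure0//; apply/seteqP; split => p //= /E w0.
by have /andP[aw _] := bounds p; move: a0; rewrite eq_le a_ge0 -w0 aw.
Qed.

Let top_point : exists p, s1 p = 0.
Proof. by have [_ _ _ [_ [p p1]] _] := omegaP; exists p; rewrite p1 subrr. Qed.

Let bot_point : exists p, s2 p = 0.
Proof. by have [_ _ _ [[p pa] _] _] := omegaP; exists p; rewrite pa subrr. Qed.

Let omega_top p : omega p = 1 + -1 * s1 p.
Proof. by rewrite /=; ring. Qed.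

Let omega_bot p : omega p = a + 1 * s2 p.
Proof. by rewrite /=; ring. Qed.

Let top_sq : -1 * -1 = 1 :> R. Proof. by ring. Qed.
Let bot_sq : 1 * 1 = 1 :> R. Proof. by ring. Qed.

Lemma top_branch_gap : top_branch omega fp.
Proof.
split => [|/(integrable_invP ms1 s1_ge0 s1_null) Iinv|Ioo m _].
- by rewrite gap0 !mulr0 addr0.
- rewrite (branch_curve momega omega01 omega_top top_sq ms1 s1_ge0 s1_le1 s1_null Iinv).
  by apply: eq_imagel => t _; rewrite mulr1 !mulN1r opprK.
- rewrite gap_infinite ?mulr0 ?addr0 ?mul1r// => /(integrable_invP ms1 s1_ge0 s1_null).
  by rewrite -[ltLHS]/(inv_gap_top omega) Ioo ltxx.
Qed.

Lemma bot_branch_gap : bot_branch omega a fm.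
Proof.
split => [|/(integrable_invP ms2 s2_ge0 s2_null) Iinv|Ioo m _].
- by rewrite gap0 !mulr0 addr0.
- rewrite (branch_curve momega omega01 omega_bot bot_sq ms2 s2_ge0 s2_le1 s2_null Iinv).
  by apply: eq_imagel => t _; rewrite !mul1r mulNr.
- rewrite gap_infinite ?mulr0 ?addr0// => /(integrable_invP ms2 s2_ge0 s2_null).
  by rewrite -[ltLHS]/(inv_gap_bot omega a) Ioo ltxx.
Qed.

Lemma top_increasing : increasing_halfline fp.
Proof. exact: sub_gap_increasing_halfline. Qed.

Lemma bot_nondecreasing : nondecreasing_halfline fm.
Proof. exact: add_gap_nondecreasing_halfline. Qed.

Lemma bot_increasing : 0 < a \/ (inv_gap_bot omega a < +oo)%E -> increasing_halfline fm.
Proof. exact: add_gap_increasing_halfline. Qed.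

Lemma top_slope : asymptotic_slope fp (beta omega).
Proof.
rewrite (_ : beta omega = 1 + -1 * (fine (dp setT) * fine (inv_gap_top omega)^-1%E)).
  exact: affine_gap_slope.
by rewrite fine_dpT mulN1r.
Qed.

Lemma bot_slope : asymptotic_slope fm (alpha omega a).
Proof.
rewrite (_ : alpha omega a = a + 1 * (fine (dp setT) * fine (inv_gap_bot omega a)^-1%E)).
  exact: affine_gap_slope.
by rewrite fine_dpT mul1r.
Qed.

Lemma bot_le_top m : 0 < m -> fm m <= fp m.
Proof.
exact: gap_two_sides.
Qed.

(* [s + s'] is constant, so excess mass at parameter [t] means excess [s']-moment. *)
Lemma complementary_moment (s s' : torus -> R) (t L m q : R) :
  measurable_fun setT s -> measurable_fun setT s' -> (forall p, 0 <= s p) ->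
  (forall p, 0 <= s' p) -> (forall p, s p + s' p = L) -> 0 < L -> 0 < t ->
  bose_gap dp s t + q = L * m ->
  (m%:E < \int[dp]_p (bose (t * s p))%:E)%E ->
  (q%:E < \int[dp]_p (s' p * bose (t * s p))%:E)%E.
Proof.
move=> ms ms' s0 s'0 ss' L0 t0 E; apply: contraTT; rewrite -!leNgt => Iq.
have b0 p : 0 <= bose (t * s p) by rewrite bose_ge0// mulr_ge0// ltW.
have mb : measurable_fun setT (fun p => bose (t * s p)).
  by apply: measurableT_comp; [exact: measurable_bose|exact: measurable_funM].
have I1 : dp.-integrable setT (EFin \o (fun p => s p * bose (t * s p))).
  have := integrable_wbose dpT_lty ms ms s0 s0 t0 (lexx 0).
  by apply: eq_integrable => // p _ /=; rewrite mul0r addr0.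
have I2 : dp.-integrable setT (EFin \o (fun p => s' p * bose (t * s p))).
  apply: ge0_integrable_fin; first exact: measurable_funM.
    by move=> p; rewrite mulr_ge0.
  by rewrite (le_lt_trans Iq)// ltry.
have -> : (\int[dp]_p (bose (t * s p))%:E)%E =
    (L^-1 * \int[dp]_p (s p * bose (t * s p)) + L^-1 * \int[dp]_p (s' p * bose (t * s p)))%:E.
  rewrite -integral_lincomb//; apply: eq_integral => p _; congr EFin.
  by rewrite -mulrDr -mulrDl ss' mulKf// gt_eqF.
rewrite lee_fin -mulrDr ler_pdivrMl// -E lerD2l.
by rewrite -lee_fin fineK// (integrable_fin_num measurableT I2).
Qed.

(** The prescribed moments of [1 - omega] and [omega - a] are [p0] and [q0], and the hypothesis says
    that each exceeds the corresponding gap at mass [M0]. So an edge equilibrium with one prescribed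
    moment has mass above [M0], hence too large a second moment; this is what
    [two_parameter_solution] requires. *)
Lemma interior_equilibrium (M0 E0 : R) : 0 < M0 -> fm M0 < E0 < fp M0 ->
  exists mu nu, [/\ forall p, 0 < mu * omega p + nu,
    mass_dens (bose_einstein omega mu nu) = M0%:E &
    energy_dens omega (bose_einstein omega mu nu) = E0%:E].
Proof.
move=> M00 /=; rewrite !mul1r mulN1r => /andP[h1 h2].
pose L := 1 - a; have L0 : 0 < L by rewrite subr_gt0.
have g1 := gap_ge0 dpT_gt0 dpT_lty ms1 s1_ge0 s1_le1 s1_null (ltW M00).
have g2 := gap_ge0 dpT_gt0 dpT_lty ms2 s2_ge0 s2_le1 s2_null (ltW M00).
pose p0 := M0 - E0; pose q0 := E0 - a * M0.
have gp : gap dp s1 M0 < p0 by rewrite /p0 ltrBrDr addrC -ltrBrDr.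
have gq : gap dp s2 M0 < q0 by rewrite /q0 ltrBrDl.
have p00 : 0 < p0 := le_lt_trans g1 gp.
have q00 : 0 < q0 := le_lt_trans g2 gq.
have pqL : p0 + q0 = L * M0 by rewrite /p0 /q0 /L; ring.
have [X0 X00 PX] := bose_gap_surj dpT_gt0 dpT_lty ms1 s1_ge0 s1_le1 s1_null p00.
have [Y0 Y00 PY] := bose_gap_surj dpT_gt0 dpT_lty ms2 s2_ge0 s2_le1 s2_null q00.
have MX : (M0%:E < \int[dp]_p (bose (X0 * s1 p))%:E)%E.
  by apply: (gap_interior dpT_gt0) => //; rewrite PX.
have MY : (M0%:E < \int[dp]_p (bose (Y0 * s2 p))%:E)%E.
  by apply: (gap_interior dpT_gt0) => //; rewrite PY.
have QX : (q0%:E < \int[dp]_p (s2 p * bose (X0 * s1 p))%:E)%E.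
  apply: (@complementary_moment s1 s2 X0 L M0) => //.
    by move=> p; rewrite /L; ring.
  by rewrite PX.
have PY' : (p0%:E < \int[dp]_p (s1 p * bose (Y0 * s2 p))%:E)%E.
  apply: (@complementary_moment s2 s1 Y0 L M0) => //.
    by move=> p; rewrite /L; ring.
  by rewrite PY addrC.
rewrite (bose_gapE _ _ s2) in PX; rewrite (bose_gapE _ _ s1) in PY.
have [x [y [x0 y0 Wx Wy]]] := two_parameter_solution dpT_gt0 dpT_lty ms1 ms2
  s1_ge0 s2_ge0 s1_null p00 X00 Y00 PX QX PY PY'.
(* Expanding [x (1 - omega) + y (omega - a)] gives [mu = y - x] and [nu = x - a y]. Positivity is
   strict because [a < 1] prevents both summands from vanishing together. *)
have tE p : (y - x) * omega p + (x - a * y) = x * s1 p + y * s2 p by ring.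
have t0 p : 0 < (y - x) * omega p + (x - a * y).
  rewrite tE; have [s1p|s1p] := ltP 0 (s1 p); first by rewrite ltr_wpDr ?mulr_gt0// mulr_ge0// ltW.
  have w1 : 1 <= omega p by rewrite -subr_le0.
  apply: ltr_wpDl; first by apply: mulr_ge0 => //; exact: ltW.
  by apply: mulr_gt0 => //; rewrite subr_gt0 (lt_le_trans a_lt1).
have tnull : dp [set p | (y - x) * omega p + (x - a * y) = 0] = 0%E.
  rewrite (_ : [set p | _] = set0) ?measure0//; apply/seteqP; split => p //= tp.
  by have := t0 p; rewrite tp ltxx.
have I1 : dp.-integrable setT (EFin \o (fun p => s1 p * bose (x * s1 p + y * s2 p))).
  by apply: integrable_wbose => //; exact: ltW.
have I2 : dp.-integrable setT (EFin \o (fun p => s2 p * bose (x * s1 p + y * s2 p))).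
  have := integrable_wbose dpT_lty ms2 ms1 s2_ge0 s1_ge0 y0 (ltW x0).
  by apply: eq_integrable => // p _ /=; rewrite [y * _ + _]addrC.
have Wy' : \int[dp]_p (s2 p * bose (x * s1 p + y * s2 p)) = q0.
  by rewrite -Wy; apply: eq_Rintegral => p _; rewrite [x * _ + _]addrC.
have t_ge0 p : 0 <= (y - x) * omega p + (x - a * y) by exact: ltW.
exists (y - x), (x - a * y); split => //.
- rewrite /mass_dens integral_bose_einstein1//.
  transitivity (L^-1 * p0 + L^-1 * q0)%:E; last by rewrite -mulrDr pqL mulKf// gt_eqF.
  rewrite -Wx -Wy' -integral_lincomb//; apply: eq_integral => p _; congr EFin.
  rewrite tE -mulrDr -mulrDl (_ : s1 p + s2 p = L); last by rewrite /L; ring.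
  by rewrite mulKf// gt_eqF.
- rewrite /energy_dens integral_bose_einstein//; last by move=> p; have /andP[] := omega01 p.
  (* The coefficients express [omega] through the two weights:
     [omega = (a / L) s1 + (a / L + 1) s2]. *)
  transitivity ((a / L) * p0 + (a / L + 1) * q0)%:E; last first.
    have -> : a / L * p0 + (a / L + 1) * q0 = a / L * (p0 + q0) + q0 by ring.
    by rewrite pqL mulrA divfK ?gt_eqF// addrC subrK.
  rewrite -Wx -Wy' -integral_lincomb//; apply: eq_integral => p _; congr EFin.
  by rewrite tE /L; field; rewrite gt_eqF.
Qed.

Lemma interior_maximizer (M0 E0 : R) : 0 < M0 -> fm M0 < E0 < fp M0 ->
  unique_equilibrium_maximizer omega M0 E0.
Proof.
move=> M00 /(interior_equilibrium M00)[mu [nu [t0 mE eE]]].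
have t_ge0 p : 0 <= mu * omega p + nu by exact: ltW.
have mn0 : (mu, nu) <> (0, 0).
  have [p _] := bot_point; move=> -[mu0 nu0].
  by have := t0 p; rewrite mu0 nu0 mul0r addr0 ltxx.
have tnull := equilibrium_null omegaP mn0 t_ge0.
exists (bose_einstein omega mu nu); split; last first.
  move=> lambda; split.
    exact: (maximizer_has_density momega omega01 t_ge0 tnull mE eE).
  exact: (has_density_maximizes momega omega01 t_ge0 tnull mE eE).
split; first by split => //; exists mu, nu; split.
move=> _ [[mu' [nu' [mn0' t_ge0' ->]]] mE' eE'].
have tnull' := equilibrium_null omegaP mn0' t_ge0'.
(* A second equilibrium with the same mass and energy is itself a maximizer, so its measure also has
   the first equilibrium as density. *)
have [l lg'] := equilibrium_has_density momega t_ge0' mE'.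
have := has_density_maximizes momega omega01 t_ge0' tnull' mE' eE' lg'.
move=> /(maximizer_has_density momega omega01 t_ge0 tnull mE eE t0) lg.
have mg : measurable_fun setT (bose_einstein omega mu nu) by exact: measurable_bose_einstein.
have mg' : measurable_fun setT (bose_einstein omega mu' nu') by exact: measurable_bose_einstein.
have Ig : dp.-integrable setT (bose_einstein omega mu nu).
  apply/integrableP; split => //.
  under eq_integral do rewrite gee0_abs ?bose_einstein_ge0//.
  by rewrite -[ltLHS]/(mass_dens (bose_einstein omega mu nu)) mE ltry.
have gg : ae_eq dp setT (bose_einstein omega mu nu) (bose_einstein omega mu' nu').
  apply: (integral_ae_eq measurableT Ig mg') => A _ mA.
  exact: etrans (esym (lg A mA)) (lg' A mA).
have [|<- <- //] := equilibrium_parameters_unique omegaP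
  (mu := mu) (nu := nu) (mu' := mu') (nu' := nu').
move: gg => [Z [mZ Z0 Zsub]].
exists Z; split => // p /= /not_implyP[_ tt]; apply: Zsub => /= /(_ Logic.I).
(* Inverting in [\bar R] recovers [e^theta - 1] even where the density is [+oo]. *)
rewrite /bose_einstein => /(congr1 (fun x => x^-1%E)); rewrite !inveK => -[].
by move=> /addIr/expR_inj.
Qed.

Lemma top_condensation (M0 E0 : R) : 0 < M0 -> fp M0 <= E0 < M0 ->
  maximizers_condense_at omega 1 M0 E0.
Proof.
move=> M00 /=; rewrite mul1r mulN1r => /andP[h1 h2].
have p00 : 0 < M0 - E0 by rewrite subr_gt0.
have pg : M0 - E0 <= gap dp s1 M0 by rewrite lerBlDr addrC -lerBlDr.
(* If [1 / s1] is not integrable the gap is 0, and no energy below [M0] satisfies the hypothesis. *)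
have [Iinv|Ninv] := pselect (dp.-integrable setT (EFin \o (fun p => (s1 p)^-1))); last first.
  by move: pg; rewrite gap_infinite// leNgt p00.
have [x sx] := top_point.
apply: (branch_condensation momega omega01 omega_top top_sq ms1 s1_ge0 s1_le1 s1_null
  Iinv M00 p00 pg _ sx).
by ring.
Qed.

Lemma bot_condensation (M0 E0 : R) : 0 < M0 -> a * M0 < E0 <= fm M0 ->
  maximizers_condense_at omega a M0 E0.
Proof.
move=> M00 /=; rewrite mul1r => /andP[h1 h2].
have p00 : 0 < E0 - a * M0 by rewrite subr_gt0.
have pg : E0 - a * M0 <= gap dp s2 M0 by rewrite lerBlDl.
have [Iinv|Ninv] := pselect (dp.-integrable setT (EFin \o (fun p => (s2 p)^-1))); last first.
  by move: pg; rewrite gap_infinite// leNgt p00.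
have [x sx] := bot_point.
apply: (branch_condensation momega omega01 omega_bot bot_sq ms2 s2_ge0 s2_le1 s2_null
  Iinv M00 p00 pg _ sx).
by ring.
Qed.

Lemma top_differentiable : differentiable_halfline fp.
Proof. exact: affine_gap_differentiable. Qed.

Lemma bot_differentiable : differentiable_halfline fm.
Proof. exact: affine_gap_differentiable. Qed.

End two_sides.

Theorem theorem1p2 (R : realType) (d : nat) (omega : torus R d -> R) (a : R)
    (omegaP : dispersion_relation omega a) :
  exists fp fm : R -> R,
    [/\ top_branch omega fp, differentiable_halfline fp,
        increasing_halfline fp & asymptotic_slope fp (beta omega)] /\
    [/\ bot_branch omega a fm, differentiable_halfline fm,
        nondecreasing_halfline fm,
        (0 < a \/ (inv_gap_bot omega a < +oo)%E -> increasing_halfline fm) &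
        asymptotic_slope fm (alpha omega a)] /\
    [/\ interior (region_between fm fp) =
          [set z | 0 < z.1 /\ fm z.1 < z.2 < fp z.1],
        above (region_between fm fp) `&` [set z | z.2 < z.1] =
          [set z | 0 < z.1 /\ fp z.1 <= z.2 < z.1] &
        below (region_between fm fp) `&` [set z | a * z.1 < z.2] =
          [set z | 0 < z.1 /\ a * z.1 < z.2 <= fm z.1]] /\
    forall M0 E0 : R, 0 < M0 -> 0 < E0 ->
      [/\ fm M0 < E0 < fp M0 -> unique_equilibrium_maximizer omega M0 E0,
          fp M0 <= E0 < M0 -> maximizers_condense_at omega 1 M0 E0 &
          a * M0 < E0 <= fm M0 -> maximizers_condense_at omega a M0 E0].
Proof.
pose dp := @torus_lebesgue R d.
pose fp m := 1 * m + -1 * gap dp (fun p => 1 - omega p) m.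
pose fm m := a * m + 1 * gap dp (fun p => omega p - a) m.
have dfp : differentiable_halfline fp := top_differentiable omegaP.
have dfm : differentiable_halfline fm := bot_differentiable omegaP.
have halfline_continuous (f : R -> R) : differentiable_halfline f ->
    forall m, 0 < m -> {for m, continuous f}.
  by move=> [df _] m /df/derivable1_diffP/differentiable_continuous.
have fmp m : 0 < m -> fm m <= fp m := bot_le_top omegaP (m := m).
exists fp, fm; split; last split; last split.
- split; [exact: (top_branch_gap omegaP)|exact: dfp|
    exact: (top_increasing omegaP)|exact: (top_slope omegaP)].
- split; [exact: (bot_branch_gap omegaP)|exact: dfm|exact: (bot_nondecreasing omegaP)|
    exact: (bot_increasing omegaP)|exact: (bot_slope omegaP)].
- split.
  + by apply: interior_region_between; exact: halfline_continuous.
  + rewrite above_region_between//; apply/seteqP.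
    by split=> -[x y] /= => [[[-> ->] ->]|[-> /andP[-> ->]]].
  + rewrite below_region_between//; apply/seteqP.
    by split=> -[x y] /= => [[[-> ->] ->]|[-> /andP[-> ->]]].
- move=> M0 E0 M00 _; split.
  + exact: (interior_maximizer omegaP).
  + exact: (top_condensation omegaP).
  + exact: (bot_condensation omegaP).
Qed.
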